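(* Let $N\ge 1$, let $Y=(y_1,\dots,y_N)\in\mathbb{W}^N$, let $x\in\mathbb{Z}$, $t\ge 0$, and let $C$ be a counterclockwise circle centered at the origin with radius $r\in(0,1)$. Then for each $k=0,1,\dots,N$, \[ \mathbb{P}_{(Y,\nu^{(k)})}(E_{t,k,x}) = \frac{1}{(2\pi i)^N}\oint_C\cdots\oint_C\prod_{i=1}^k(1-\xi_i)\prod_{1\leq i<j\leq N}\frac{\xi_j-\xi_i}{1-\xi_i}\prod_{i=1}^N\frac{1}{1-\xi_i}\prod_{i=1}^N\Big(\xi_i^{x-y_i-1}e^{\varepsilon(\xi_i)t}\Big)\,d\xi_1\cdots d\xi_N, \] where $\prod_{i=1}^0(\cdot)=1$.
   Context: TASEP with second class particles: $N$ particles occupy distinct sites of $\mathbb{Z}$; each particle carries a label $1$ or $2$ (label-$2$ particles are ''first class'', label-$1$ particles are ''second class''). Each particle independently, at rate $1$ (after an exponential waiting time with mean 1), attempts to jump to the neighboring site to its right: if that site is empty the jump occurs; if it is occupied by a particle of the same label the jump is suppressed; if a label-$2$ particle attempts to jump onto a site occupied by a label-$1$ particle, the two particles exchange positions; if a label-$1$ particle attempts to jump onto a site occupied by a label-$2$ particle, the jump is suppressed. $\mathbb{W}^N=\{(x_1,\dots,x_N)\in\mathbb{Z}^N: x_1<\dots<x_N\}$. A state is a pair $(X,\pi)$ with $X=(x_1,\dots,x_N)\in\mathbb{W}^N$ and $\pi=(\pi_1\cdots\pi_N)\in\{1,2\}^N$, meaning the $i$-th particle from the left is at $x_i$ and has label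 $\pi_i$. For $1\le k\le N$, $\nu^{(k)}$ is the sequence with $\nu^{(k)}_1=\dots=\nu^{(k)}_k=2$ and $\nu^{(k)}_{k+1}=\dots=\nu^{(k)}_N=1$; $\nu^{(0)}=(1,\dots,1)$. For $1\le k\le N$, $E_{t,k,x}$ is the event that at time $t$ the state is $(X,\nu^{(k)})$ for some $X$ with $x_1=x,x_2=x+1,\dots,x_k=x+k-1$ (i.e., the labels are still in the order $\nu^{(k)}$ and the $k$ first class particles occupy $x,\dots,x+k-1$); $E_{t,0,x}$ is the event that at time $t$ the state is $(X,\nu^{(0)})$ with $x_1\ge x$. $\mathbb{P}_{(Y,\nu)}$ is the law of the process started from state $(Y,\nu)$. $\varepsilon(\xi)=1/\xi-1$. *)

(* Defs.v *)
From Stdlib Require Import Reals Lra ZArith List Sorted.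
Import ListNotations.
Open Scope R_scope.

Record C := mkC { Re : R; Im : R }.
Definition RtoC (a : R) : C := mkC a 0.
Definition C0 : C := RtoC 0.
Definition C1 : C := RtoC 1.
Definition Ci : C := mkC 0 1.
Definition Cadd (z w : C) : C := mkC (Re z + Re w) (Im z + Im w).
Definition Copp (z : C) : C := mkC (- Re z) (- Im z).
Definition Csub (z w : C) : C := Cadd z (Copp w).
Definition Cmul (z w : C) : C :=
  mkC (Re z * Re w - Im z * Im w) (Re z * Im w + Im z * Re w).
Definition Cinv (z : C) : C :=
  let d := Re z * Re z + Im z * Im z in mkC (Re z / d) (- Im z / d).
Definition Cdiv (z w : C) : C := Cmul z (Cinv w).
Definition Cexp (z : C) : C := mkC (exp (Re z) * cos (Im z)) (exp (Re z) * sin (Im z)).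
Fixpoint Cpow (z : C) (n : nat) : C :=
  match n with O => C1 | S m => Cmul z (Cpow z m) end.
Definition CpowZ (z : C) (n : Z) : C :=
  match n with
  | Z0 => C1
  | Zpos p => Cpow z (Pos.to_nat p)
  | Zneg p => Cinv (Cpow z (Pos.to_nat p))
  end.
Definition Cprod (l : list nat) (f : nat -> C) : C :=
  fold_right (fun i acc => Cmul (f i) acc) C1 l.
Definition Csum {A} (l : list A) (f : A -> C) : C :=
  fold_right (fun a acc => Cadd (f a) acc) C0 l.

(** A state (X, pi) is the list [(x_1,pi_1); ...; (x_N,pi_N)] ordered left to
    right; labels are the naturals 1 (second class) and 2 (first class). *)
Definition state := list (Z * nat).

Fixpoint jump (i : nat) (s : state) : state :=
  match s with
  | [] => []
  | (x, a) :: rest =>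
      match i with
      | S i' => (x, a) :: jump i' rest
      | O =>
          match rest with
          | [] => [(x + 1, a)%Z]
          | (z, b) :: rest' =>
              if Z.eqb z (x + 1)%Z then
                if (Nat.eqb a 2 && Nat.eqb b 1)%bool
                then (x, b) :: (z, a) :: rest'
                else s
              else (x + 1, a)%Z :: rest
          end
      end
  end.

Fixpoint count_paths (N : nat) (E : state -> bool) (n : nat) (s : state) : R :=
  match n with
  | O => if E s then 1 else 0
  | S m => fold_right (fun i acc => count_paths N E m (jump i s) + acc) 0 (seq 0 N)
  end.

(** Poisson clock (uniformization) construction: in time t the total number of
    jump attempts is Poisson(N t), and given it is n the sequence of attempting
    particles is uniform over {0..N-1}^n. Hence
    P_s(state at time t in E) = sum_n e^{-N t} t^n / n! * count_paths N E n s. *)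
Definition prob_series (N : nat) (E : state -> bool) (t : R) (s : state) (n : nat) : R :=
  exp (- INR N * t) * t ^ n / INR (fact n) * count_paths N E n s.

Definition is_prob (N : nat) (s : state) (t : R) (E : state -> bool) (p : R) : Prop :=
  infinite_sum (prob_series N E t s) p.

Definition nu (N k : nat) : list nat := repeat 2%nat k ++ repeat 1%nat (N - k).

Definition list_nat_eqb (l1 l2 : list nat) : bool :=
  if list_eq_dec Nat.eq_dec l1 l2 then true else false.

Definition event_E (N k : nat) (x : Z) (s : state) : bool :=
  let X := map fst s in
  let lab := map snd s in
  match k with
  | O => list_nat_eqb lab (nu N 0) && (x <=? nth 0 X 0%Z)%Z
  | S _ => list_nat_eqb lab (nu N k) &&
           forallb (fun j => Z.eqb (nth j X 0%Z) (x + Z.of_nat j)%Z) (seq 0 k)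
  end.

Definition init_state (N k : nat) (Y : list Z) : state := combine Y (nu N k).

Fixpoint grid (N M : nat) : list (list nat) :=
  match N with
  | O => [[]]
  | S n => flat_map (fun m => map (cons m) (grid n M)) (seq 0 M)
  end.

Definition circ (r theta : R) : C := mkC (r * cos theta) (r * sin theta).

(** Uniform (left endpoint) Riemann sum with M subdivisions per variable of the
    parametrized N-fold integral
      int_{[0,2pi]^N} f(r e^{i th_1},...,r e^{i th_N}) prod_j (i r e^{i th_j}) dth,
    which equals oint_C ... oint_C f(xi) dxi_1 ... dxi_N. *)
Definition circle_riemann_sum (N : nat) (r : R) (f : list C -> C) (M : nat) : C :=
  let h := 2 * PI / INR M in
  Csum (grid N M) (fun ms =>
    let xi := map (fun m => circ r (h * INR m)) ms in
    Cmul (RtoC (h ^ N))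
      (Cmul (f xi) (fold_right (fun z acc => Cmul (Cmul Ci z) acc) C1 xi))).

(** [is_circle_integral N r f I] : the N-fold contour integral of f over the
    counterclockwise circle |xi| = r (each variable) equals I (defined as the
    limit of uniform Riemann sums, which is the Riemann integral for
    continuous integrands). *)
Definition is_circle_integral (N : nat) (r : R) (f : list C -> C) (I : C) : Prop :=
  forall eps : R, eps > 0 -> exists M0 : nat, forall M : nat, (M >= M0)%nat ->
    Rabs (Re (circle_riemann_sum N r f M) - Re I) < eps /\
    Rabs (Im (circle_riemann_sum N r f M) - Im I) < eps.

Definition veps (z : C) : C := Csub (Cinv z) C1.

(** The integrand, with 0-indexed variables xi_0..xi_{N-1} (xi_{i} = paper's xi_{i+1}). *)
Definition integrand (N k : nat) (x : Z) (Y : list Z) (t : R) (xi : list C) : C :=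
  let z i := nth i xi C0 in
  Cmul (Cprod (seq 0 k) (fun i => Csub C1 (z i)))
  (Cmul (Cprod (seq 0 N) (fun j =>
           Cprod (seq 0 j) (fun i => Cdiv (Csub (z j) (z i)) (Csub C1 (z i)))))
  (Cmul (Cprod (seq 0 N) (fun i => Cinv (Csub C1 (z i))))
        (Cprod (seq 0 N) (fun i =>
           Cmul (CpowZ (z i) (x - nth i Y 0%Z - 1)%Z)
                (Cexp (Cmul (veps (z i)) (RtoC t))))))).

(* Main.v *)
(** By uniformization the probability is
    [e^(-Nt) sum_n t^n/n! A_n(Y)], where [A_n(Y)] counts the [n]-step sequences of
    attempts leading from [(Y, nu^(k))] to the event. On the other side the Vandermonde
    product turns the integrand into a determinant whose rows depend on one variable
    each, and the coefficient of [z^d] in [(1 - z)^-m] is a binomial number [h_m(d)].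
    So the integral is [e^(-Nt) sum_n t^n/n! (L^n u)(Y)], where [L] is the sum of the [N]
    unit shifts and [u(Y) = det h_(m_i)(y_i - x - j)] with [m_i = N - i - [i < k]]
    ([i] and [j] from 0).
    Then [A_n = L^n u] by induction on [n] (Bethe ansatz): a blocked jump and an
    exchange of labels correspond to boundary conditions of [L^n u], which follow
    from antisymmetry of determinants, and at [n = 0] column operations reduce [u]
    to the indicator of the event.

    The contour integral being a limit of uniform Riemann sums, it is computed by
    orthogonality of roots of unity and uniform truncation of Laurent series. *)

From HB Require structures.
From Corelib Require ssreflect.
From Stdlib Require FunctionalExtensionality Lra Lia.
From Coquelicot Require Coquelicot.
From mathcomp Require all_boot all_order all_fingroup all_algebra Rstruct zify.
From Pilot Require Import Defs.
From Stdlib Require Import Reals ZArith List Sorted.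
Open Scope R_scope.

(** The exponents [m_i] drop by 1 from each [i] to [i + 1], except from [k - 1] to [k], where they
    agree; this is how the determinant knows the labels. Where they drop, differencing in [y_i]
    lowers row [i] to the exponent of row [i + 1], so the difference is antisymmetric in
    [y_i, y_(i+1)] and vanishes when these coincide: the blocked jump. Where they agree, the
    determinant itself is antisymmetric and vanishes: the exchange, after which the labels never
    return to [nu N k]. Antisymmetry survives [L], while an identity confined to adjacent positions
    does not. Hence the free evolution is defined at all integer vectors, also those with coinciding
    coordinates.

    In the sum over [n], the shifts commute, so the exponential series of [L] on a product of
    one-variable functions factors into one-variable series. The latter are infinite in general:
    [e^(t/z)] has an essential singularity inside the circle, and each of its terms can pair with a
    term of [(1 - z)^-m]. *)

Module Analysis.
Import ssreflect Lra Lia Coquelicot.Coquelicot Pilot.Defs ListNotations.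

(** * Complex numbers, circles and limits *)

Lemma C_ext (z w : C) : Re z = Re w -> Im z = Im w -> z = w.
Proof. by destruct z, w; simpl; intros -> ->. Qed.

Lemma C_ring_theory : ring_theory C0 C1 Cadd Cmul Csub Copp eq.
Proof. split; intros; apply C_ext; simpl; ring. Qed.
Add Ring C_ring : C_ring_theory.

Definition cnorm (z : C) : R := sqrt (Re z * Re z + Im z * Im z).

Lemma cnorm_mul (z w : C) : cnorm (Cmul z w) = cnorm z * cnorm w.
Proof.
rewrite /cnorm -sqrt_mult; try nra.
f_equal; simpl; ring.
Qed.

Lemma cnorm_add (z w : C) : cnorm (Cadd z w) <= cnorm z + cnorm w.
Proof.
pose proof (Cmod_triangle (Re z, Im z) (Re w, Im w)) as H.
rewrite /Cmod /= in H; rewrite /cnorm /=.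
now rewrite ?Rmult_1_r in H.
Qed.

Lemma cnorm_ge0 (z : C) : 0 <= cnorm z.
Proof. apply sqrt_pos. Qed.

Lemma Re_le_cnorm (z : C) : Rabs (Re z) <= cnorm z.
Proof.
rewrite -sqrt_Rsqr_abs; apply sqrt_le_1; rewrite /Rsqr; nra.
Qed.

Lemma Im_le_cnorm (z : C) : Rabs (Im z) <= cnorm z.
Proof.
rewrite -sqrt_Rsqr_abs; apply sqrt_le_1; rewrite /Rsqr; nra.
Qed.

Lemma cnorm_le_parts (z : C) : cnorm z <= Rabs (Re z) + Rabs (Im z).
Proof.
pose proof (Rabs_pos (Re z)); pose proof (Rabs_pos (Im z)).
rewrite -[X in _ <= X]sqrt_Rsqr; [|lra].
apply sqrt_le_1; rewrite /Rsqr; try nra.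
rewrite -[Re z * Re z]Rabs_pos_eq; [|nra].
rewrite -[Im z * Im z]Rabs_pos_eq; [|nra].
rewrite !Rabs_mult; nra.
Qed.

Lemma cnorm_RtoC (a : R) : cnorm (RtoC a) = Rabs a.
Proof. by rewrite /cnorm /= Rmult_0_l Rplus_0_r sqrt_Rsqr_abs. Qed.

Lemma cnorm_opp (z : C) : cnorm (Copp z) = cnorm z.
Proof. rewrite /cnorm /=; f_equal; ring. Qed.

Lemma cnorm_eq0 (z : C) : cnorm z = 0 -> z = C0.
Proof.
intros H.
pose proof (Re_le_cnorm z); pose proof (Im_le_cnorm z).
pose proof (Rabs_pos (Re z)); pose proof (Rabs_pos (Im z)).
apply C_ext; simpl; apply Rabs_eq_0; lra.
Qed.

Lemma cnorm_C0 : cnorm C0 = 0.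
Proof. by rewrite /C0 cnorm_RtoC Rabs_R0. Qed.

Lemma Cmul_inv (z : C) : z <> C0 -> Cmul z (Cinv z) = C1.
Proof.
intros Hz.
assert (H : Re z * Re z + Im z * Im z <> 0).
{ intros H; apply Hz, cnorm_eq0; by rewrite /cnorm H sqrt_0. }
apply C_ext; simpl; field; exact H.
Qed.

Lemma cnorm_inv (z : C) : z <> C0 -> cnorm (Cinv z) = / cnorm z.
Proof.
intros Hz.
assert (H : cnorm z <> 0) by (intros H; apply Hz, cnorm_eq0, H).
apply (Rmult_eq_reg_l (cnorm z)); [|exact H].
rewrite -cnorm_mul Cmul_inv // /C1 cnorm_RtoC Rabs_R1; by field.
Qed.

Lemma cnorm_pow (z : C) (n : nat) : cnorm (Cpow z n) = cnorm z ^ n.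
Proof.
induction n as [|n IH]; simpl.
- by rewrite /C1 cnorm_RtoC Rabs_R1.
- by rewrite cnorm_mul IH.
Qed.

Lemma circ_mul (a b u v : R) : Cmul (circ a u) (circ b v) = circ (a * b) (u + v).
Proof. apply C_ext; simpl; rewrite ?cos_plus ?sin_plus; ring. Qed.

Lemma circ_0 (a : R) : circ a 0 = RtoC a.
Proof. apply C_ext; simpl; rewrite ?cos_0 ?sin_0; ring. Qed.

Lemma cnorm_circ (a u : R) : 0 <= a -> cnorm (circ a u) = a.
Proof.
intros Ha; rewrite /cnorm /=.
replace (_ + _) with (a * a * (Rsqr (sin u) + Rsqr (cos u))); [|rewrite /Rsqr; ring].
by rewrite sin2_cos2 Rmult_1_r sqrt_square.
Qed.

Lemma circ_inv (a u : R) : a <> 0 -> Cinv (circ a u) = circ (/ a) (- u).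
Proof.
intros Ha.
assert (H : a * cos u * (a * cos u) + a * sin u * (a * sin u) = a * a).
{ replace (_ + _) with (a * a * (Rsqr (sin u) + Rsqr (cos u))); [|rewrite /Rsqr; ring].
  by rewrite sin2_cos2 Rmult_1_r. }
apply C_ext; simpl; rewrite H ?cos_neg ?sin_neg; by field.
Qed.

Lemma circ_pow (a u : R) (n : nat) : Cpow (circ a u) n = circ (a ^ n) (INR n * u).
Proof.
induction n as [|n IH].
- by rewrite /= Rmult_0_l circ_0.
- rewrite S_INR /= IH circ_mul; f_equal; ring.
Qed.

Lemma circ_powZ (a u : R) (q : Z) :
  a <> 0 -> CpowZ (circ a u) q = circ (powerRZ a q) (IZR q * u).
Proof.
intros Ha; destruct q as [|p|p]; simpl.
- by rewrite Rmult_0_l circ_0.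
- by rewrite circ_pow INR_IZR_INZ positive_nat_Z.
- rewrite circ_pow circ_inv; [|by apply pow_nonzero].
  rewrite INR_IZR_INZ positive_nat_Z -(Pos2Z.opp_pos p) opp_IZR; f_equal; ring.
Qed.

Lemma circ_powZ_add (a u : R) (p q : Z) : a <> 0 ->
  Cmul (CpowZ (circ a u) p) (CpowZ (circ a u) q) = CpowZ (circ a u) (p + q).
Proof.
intros Ha; rewrite !circ_powZ // circ_mul powerRZ_add // plus_IZR; f_equal; ring.
Qed.

Lemma cnorm_circ_powZ (a u : R) (q : Z) :
  0 < a -> cnorm (CpowZ (circ a u) q) = powerRZ a q.
Proof.
intros Ha; rewrite circ_powZ; [|lra].
by apply cnorm_circ, powerRZ_le.
Qed.

Definition clim (u : nat -> C) (l : C) : Prop :=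
  is_lim_seq (fun n => Re (u n)) (Re l) /\ is_lim_seq (fun n => Im (u n)) (Im l).

Lemma clim_add (u v : nat -> C) (a b : C) :
  clim u a -> clim v b -> clim (fun n => Cadd (u n) (v n)) (Cadd a b).
Proof. intros [] []; split; simpl; by apply is_lim_seq_plus'. Qed.

Lemma clim_mul (u v : nat -> C) (a b : C) :
  clim u a -> clim v b -> clim (fun n => Cmul (u n) (v n)) (Cmul a b).
Proof.
intros [] []; split; simpl;
  [apply is_lim_seq_minus' | apply is_lim_seq_plus']; by apply is_lim_seq_mult'.
Qed.

Lemma clim_const (a : C) : clim (fun _ => a) a.
Proof. split; apply is_lim_seq_const. Qed.

Lemma clim_ext (u v : nat -> C) (a : C) : (forall n, u n = v n) -> clim u a -> clim v a.
Proof.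
intros H [H1 H2]; split; [eapply is_lim_seq_ext, H1 | eapply is_lim_seq_ext, H2];
  intros n; by rewrite /= H.
Qed.

Lemma clim_ext_loc (u v : nat -> C) (a : C) (N : nat) :
  (forall n, (N <= n)%nat -> u n = v n) -> clim u a -> clim v a.
Proof.
intros H [H1 H2]; split; [eapply is_lim_seq_ext_loc, H1 | eapply is_lim_seq_ext_loc, H2];
  exists N; intros n Hn; by rewrite /= H.
Qed.

Lemma climP (u : nat -> C) (l : C) : clim u l <->
  forall eps, 0 < eps -> exists N, forall n, (N <= n)%nat -> cnorm (Csub (u n) l) < eps.
Proof.
split.
- intros [H1 H2] eps Heps.
  apply is_lim_seq_spec in H1; apply is_lim_seq_spec in H2.
  assert (He : 0 < eps / 2) by lra.
  destruct (H1 (mkposreal _ He)) as [N1 HN1]; destruct (H2 (mkposreal _ He)) as [N2 HN2].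
  exists (Nat.max N1 N2); intros n Hn.
  specialize (HN1 n ltac:(lia)); specialize (HN2 n ltac:(lia)); simpl in *.
  apply Rle_lt_trans with (1 := cnorm_le_parts _); simpl.
  rewrite /Rminus in HN1, HN2; lra.
- intros H; split; apply is_lim_seq_spec; intros [eps Heps]; destruct (H eps Heps) as [N HN];
    exists N; intros n Hn; specialize (HN n Hn); simpl.
  + apply Rle_lt_trans with (2 := HN).
    apply Rle_trans with (2 := Re_le_cnorm _); simpl; rewrite /Rminus; lra.
  + apply Rle_lt_trans with (2 := HN).
    apply Rle_trans with (2 := Im_le_cnorm _); simpl; rewrite /Rminus; lra.
Qed.

(** * Means over circles *)

Fixpoint csum (g : nat -> C) (n : nat) : C :=
  match n with O => C0 | S m => Cadd (csum g m) (g m) end.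

Lemma csum_ext (g h : nat -> C) (n : nat) :
  (forall i, (i < n)%nat -> g i = h i) -> csum g n = csum h n.
Proof.
induction n as [|n IH]; intros H; simpl; auto.
rewrite IH ?H //; intros; apply H; lia.
Qed.

Lemma csum_add (g h : nat -> C) (n : nat) :
  csum (fun i => Cadd (g i) (h i)) n = Cadd (csum g n) (csum h n).
Proof. induction n as [|n IH]; simpl; [|rewrite IH]; ring. Qed.

Lemma csum_mul (a : C) (g : nat -> C) (n : nat) :
  csum (fun i => Cmul a (g i)) n = Cmul a (csum g n).
Proof. induction n as [|n IH]; simpl; [|rewrite IH]; ring. Qed.

Lemma cnorm_csum (g : nat -> C) (n : nat) (B : R) :
  (forall i, cnorm (g i) <= B) -> cnorm (csum g n) <= INR n * B.
Proof.
intros H; induction n as [|n IH].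
- by rewrite /= cnorm_C0 Rmult_0_l; apply Rle_refl.
- rewrite S_INR /=; apply Rle_trans with (1 := cnorm_add _ _).
  specialize (H n); lra.
Qed.

Lemma csum_geom (a : R) (n : nat) :
  Cmul (csum (fun i => circ 1 (a * INR i)) n) (Csub (circ 1 a) C1)
  = Csub (circ 1 (a * INR n)) C1.
Proof.
induction n as [|n IH].
- rewrite /= Rmult_0_r circ_0 /C1; ring.
- rewrite [csum _ _]/=.
  replace (circ 1 (a * INR (S n))) with (Cmul (circ 1 (a * INR n)) (circ 1 a)).
  + transitivity (Cadd (Cmul (csum (fun i => circ 1 (a * INR i)) n) (Csub (circ 1 a) C1))
                       (Cmul (circ 1 (a * INR n)) (Csub (circ 1 a) C1))); [ring|].
    rewrite IH; ring.
  + rewrite circ_mul S_INR; f_equal; ring.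
Qed.

Lemma circ_full_turns (q : Z) : circ 1 (2 * PI * IZR q) = C1.
Proof.
assert (H : sin (IZR q * PI) = 0) by (apply sin_eq_0_1; by exists q).
replace (2 * PI * IZR q) with (2 * (IZR q * PI)) by ring.
apply C_ext; rewrite /circ ?Rmult_1_l.
- rewrite [Re _]/= cos_2a_sin H; simpl; ring.
- rewrite [Im _]/= sin_2a H; simpl; ring.
Qed.

(** By [cos a = 1 - 2 sin^2 (a/2)], a cosine equal to 1 would force [sin (|a|/2) = 0]. *)
Lemma circ_partial_turn (a : R) : 0 < Rabs a < 2 * PI -> circ 1 a <> C1.
Proof.
intros Ha H; apply (f_equal Re) in H; simpl in H.
assert (Hc : cos (Rabs a) = 1).
{ rewrite /Rabs; destruct (Rcase_abs a); rewrite ?cos_neg; lra. }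
replace (Rabs a) with (2 * (Rabs a / 2)) in Hc by field.
rewrite cos_2a_sin in Hc.
assert (0 < sin (Rabs a / 2)) by (apply sin_gt_0; lra).
nra.
Qed.

(** The bound on [q] keeps [2 pi q / M] below a full turn, so for [q <> 0] the ratio of the
    geometric sum is not 1, while its [M]-th power is. *)
Lemma csum_roots_of_unity (q : Z) (M : nat) : (Z.abs q < Z.of_nat M)%Z ->
  csum (fun l => circ 1 (IZR q * (2 * PI / INR M * INR l))) M
  = if (q =? 0)%Z then RtoC (INR M) else C0.
Proof.
intros HM.
assert (HM0 : 0 < INR M) by (apply lt_0_INR; lia).
destruct (Z.eqb_spec q 0) as [->|Hq].
- clear; generalize (2 * PI / INR M) as c; intros c.
  induction M as [|M IH]; simpl; auto.
  rewrite IH Rmult_0_l circ_0 -/(INR (S M)) S_INR; apply C_ext; simpl; ring.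
- set a := IZR q * (2 * PI / INR M).
  rewrite (csum_ext _ (fun l => circ 1 (a * INR l))); last first.
  { intros i _; rewrite /a; f_equal; ring. }
  pose proof (csum_geom a M) as H.
  replace (a * INR M) with (2 * PI * IZR q) in H; last by rewrite /a; field; lra.
  rewrite circ_full_turns in H.
  assert (Ha : Csub (circ 1 a) C1 <> C0).
  { intros Ha; apply (circ_partial_turn a).
    - pose proof PI_RGT_0.
      assert (1 <= Rabs (IZR q) < INR M).
      { rewrite -abs_IZR INR_IZR_INZ; split; [apply IZR_le|apply IZR_lt]; lia. }
      rewrite /a Rabs_mult [Rabs (_ / _)]Rabs_pos_eq; last first.
      { apply Rlt_le, Rdiv_lt_0_compat; lra. }
      assert (0 < 2 * PI / INR M) by (apply Rdiv_lt_0_compat; lra).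
      assert (Hc : INR M * (2 * PI / INR M) = 2 * PI) by (field; lra).
      rewrite -{3}Hc; nra.
    - transitivity (Cadd (Csub (circ 1 a) C1) C1); [ring|rewrite Ha; ring]. }
  set s := csum _ _ in H *.
  transitivity (Cmul (Cmul s (Csub (circ 1 a) C1)) (Cinv (Csub (circ 1 a) C1))).
  + transitivity (Cmul s (Cmul (Csub (circ 1 a) C1) (Cinv (Csub (circ 1 a) C1)))).
    * rewrite Cmul_inv //; ring.
    * ring.
  + rewrite H; ring.
Qed.

Definition average (r : R) (g : C -> C) (M : nat) : C :=
  Cmul (RtoC (/ INR M)) (csum (fun l => g (circ r (2 * PI / INR M * INR l))) M).

(** [c] is the mean of [g] on the circle, i.e. [1/(2 pi i)] times the contour
    integral of [g z / z]. *)
Definition mean (r : R) (g : C -> C) (c : C) : Prop := clim (average r g) c.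

Lemma mean_ext (r : R) (g h : C -> C) (c : C) :
  (forall u, g (circ r u) = h (circ r u)) -> mean r g c -> mean r h c.
Proof.
intros H; apply clim_ext; intros n; rewrite /average; f_equal.
by apply csum_ext; intros i _; rewrite H.
Qed.

Lemma mean_add (r : R) (g h : C -> C) (c d : C) :
  mean r g c -> mean r h d -> mean r (fun z => Cadd (g z) (h z)) (Cadd c d).
Proof.
intros Hg Hh; eapply clim_ext; [|exact (clim_add _ _ _ _ Hg Hh)].
intros n; rewrite /average csum_add; ring.
Qed.

Lemma mean_scal (r : R) (a : C) (g : C -> C) (c : C) :
  mean r g c -> mean r (fun z => Cmul a (g z)) (Cmul a c).
Proof.
intros Hg; eapply clim_ext; [|exact (clim_mul _ _ _ _ (clim_const a) Hg)].
intros n; rewrite /average csum_mul; ring.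
Qed.

(** The averages are eventually constant: they equal the limit as soon as [M] exceeds [|q|]. *)
Lemma mean_powZ (r : R) (q : Z) : 0 < r ->
  mean r (fun z => CpowZ z q) (if (q =? 0)%Z then C1 else C0).
Proof.
intros Hr; apply (clim_ext_loc (fun _ => if (q =? 0)%Z then C1 else C0) _ _ (S (Z.to_nat (Z.abs q)))).
2: apply clim_const.
intros M HM; rewrite /average.
rewrite (csum_ext _ (fun l => Cmul (RtoC (powerRZ r q))
   (circ 1 (IZR q * (2 * PI / INR M * INR l))))); last first.
{ intros i _; rewrite circ_powZ; last lra.
  rewrite -circ_0 circ_mul; f_equal; ring. }
rewrite csum_mul csum_roots_of_unity; last lia.
destruct (Z.eqb_spec q 0) as [->|Hq]; [|ring].
assert (0 < INR M) by (apply lt_0_INR; lia).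
apply C_ext; simpl; field; lra.
Qed.

Lemma average_sub_le (r : R) (g h : C -> C) (B : R) (M : nat) : (0 < M)%nat ->
  (forall u, cnorm (Csub (g (circ r u)) (h (circ r u))) <= B) ->
  cnorm (Csub (average r g M) (average r h M)) <= B.
Proof.
intros HM H.
assert (0 < INR M) by (apply lt_0_INR; lia).
assert (HI : 0 < / INR M) by (by apply Rinv_0_lt_compat).
set D := csum (fun l => Csub (g (circ r (2 * PI / INR M * INR l)))
                             (h (circ r (2 * PI / INR M * INR l)))) M.
replace (Csub _ _) with (Cmul (RtoC (/ INR M)) D).
- rewrite cnorm_mul cnorm_RtoC Rabs_pos_eq; [|lra].
  apply (Rmult_le_reg_l (INR M)); auto.
  rewrite -Rmult_assoc Rinv_r ?Rmult_1_l; [|lra].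
  apply cnorm_csum; intros; apply H.
- rewrite /average /D.
  transitivity (Cmul (RtoC (/ INR M)) (Cadd (csum (fun l => g (circ r (2 * PI / INR M * INR l))) M) (Cmul (Copp C1) (csum (fun l => h (circ r (2 * PI / INR M * INR l))) M)))); [|ring].
  rewrite -(csum_mul (Copp C1)) -csum_add; f_equal; apply csum_ext; intros; ring.
Qed.

(** [average_sub_le] bounds the error for all [M > 0] at once, so approximation and limit in [M] can
    be exchanged. This is what permits truncating Laurent series. *)
Lemma mean_uniform (r : R) (g : C -> C) (c : C) :
  (forall eps, 0 < eps -> exists g' c',
    (forall u, cnorm (Csub (g (circ r u)) (g' (circ r u))) <= eps) /\
    cnorm (Csub c' c) <= eps /\ mean r g' c') ->
  mean r g c.
Proof.
intros H; apply climP; intros eps Heps.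
destruct (H (eps / 4)) as (g' & c' & Hg & Hc & Hm); [lra|].
apply climP with (eps := eps / 4) in Hm; [|lra].
destruct Hm as [N HN]; exists (S N); intros n Hn.
specialize (HN n ltac:(lia)).
pose proof (average_sub_le r g g' _ n ltac:(lia) Hg).
replace (Csub (average r g n) c) with
  (Cadd (Csub (average r g n) (average r g' n)) (Cadd (Csub (average r g' n) c') (Csub c' c))); [|ring].
pose proof (cnorm_add (Csub (average r g n) (average r g' n)) (Cadd (Csub (average r g' n) c') (Csub c' c))).
pose proof (cnorm_add (Csub (average r g' n) c') (Csub c' c)).
lra.
Qed.

(** * Coefficients of negative binomial series *)

(** [hn m a] is the coefficient of [z^a] in [(1 - z)^-m]. *)
Fixpoint hn (m : nat) : nat -> R :=
  match m with
  | O => fun a => match a with O => 1 | S _ => 0 end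
  | S m' => fix g a := match a with O => 1 | S a' => hn m' (S a') + g a' end
  end.

(** Extension by zero makes the recurrence [hcoef_S] hold at every integer. *)
Definition hcoef (m : nat) (d : Z) : R :=
  if (d <? 0)%Z then 0 else hn m (Z.to_nat d).

Lemma hn_0 (m : nat) : hn m 0 = 1.
Proof. by destruct m. Qed.

(** Crude, but [2^n t^n / n!] is still summable, which suffices for domination. *)
Lemma hn_bound (m a : nat) : 0 <= hn m a <= 2 ^ (m + a).
Proof.
revert a; induction m as [|m IHm]; induction a as [|a IHa].
- simpl; lra.
- split; [simpl; lra|apply pow_le; lra].
- rewrite hn_0; split; [lra|apply pow_R1_Rle; lra].
- change (hn (S m) (S a)) with (hn m (S a) + hn (S m) a).
  specialize (IHm (S a)).
  replace (S m + S a)%nat with (S (m + S a)) by lia.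
  replace (S m + a)%nat with (m + S a)%nat in IHa by lia.
  simpl pow; lra.
Qed.

Lemma hcoef_neg (m : nat) (d : Z) : (d < 0)%Z -> hcoef m d = 0.
Proof. intros H; rewrite /hcoef; destruct (Z.ltb_spec d 0); [auto|lia]. Qed.

Lemma hcoef_0 (m : nat) : hcoef m 0 = 1.
Proof. apply hn_0. Qed.

Lemma hcoef_pos0 (d : Z) : (0 < d)%Z -> hcoef 0 d = 0.
Proof.
intros H; rewrite /hcoef; destruct (Z.ltb_spec d 0); auto.
destruct (Z.to_nat d) eqn:E; [lia|auto].
Qed.

Lemma hcoef_S (m : nat) (d : Z) : hcoef (S m) d = hcoef m d + hcoef (S m) (d - 1).
Proof.
rewrite /hcoef; destruct (Z.ltb_spec d 0), (Z.ltb_spec (d - 1) 0); try lia.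
- ring.
- replace d with 0%Z by lia; rewrite !hn_0; ring.
- by replace (Z.to_nat d) with (S (Z.to_nat (d - 1))) by lia.
Qed.

Lemma hcoef_ge0 (m : nat) (d : Z) : 0 <= hcoef m d.
Proof. rewrite /hcoef; destruct (Z.ltb_spec d 0); [lra|apply hn_bound]. Qed.

Lemma hcoef_bound (m : nat) (d : Z) : hcoef m d <= 2 ^ (m + Z.to_nat d).
Proof.
rewrite /hcoef; destruct (Z.ltb_spec d 0); [apply pow_le; lra|apply hn_bound].
Qed.

Definition egf (t : R) (a : nat -> R) (n : nat) : R := t ^ n / INR (fact n) * a n.

(** Coefficient of [z^d] in [(1 - z)^-m e^(t/z)], expanded in [0 < |z| < 1]. *)
Definition hegf (m : nat) (d : Z) (t : R) : R :=
  Series (egf t (fun n => hcoef m (d + Z.of_nat n))).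

Lemma egf_ge0 (t : R) (a : nat -> R) (n : nat) : 0 <= t -> 0 <= a n -> 0 <= egf t a n.
Proof.
intros Ht Ha; apply Rmult_le_pos; auto.
apply Rmult_le_pos; [by apply pow_le|].
apply Rlt_le, Rinv_0_lt_compat, INR_fact_lt_0.
Qed.

Lemma is_series_exp (t : R) : is_series (fun n => t ^ n / INR (fact n)) (exp t).
Proof.
eapply is_series_ext; [|exact (is_exp_Reals t)].
intros n; by rewrite /scal /= /mult /= pow_n_pow.
Qed.

Lemma egf_geom_dom (t B : R) (a : nat -> R) : 0 <= t ->
  (forall n, 0 <= a n <= B * 2 ^ n) ->
  ex_series (egf t a) /\ 0 <= Series (egf t a) <= B * exp (2 * t).
Proof.
intros Ht H.
assert (HB : is_series (fun n => scal B ((2 * t) ^ n / INR (fact n))) (scal B (exp (2 * t)))).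
{ by apply (is_series_scal_l (V := R_NormedModule)), is_series_exp. }
assert (Hle : forall n, 0 <= egf t a n <= scal B ((2 * t) ^ n / INR (fact n))).
{ intros n; specialize (H n); split; [apply egf_ge0; tauto|].
  rewrite /egf /scal /= /mult /= Rpow_mult_distr.
  replace (B * (2 ^ n * t ^ n / INR (fact n))) with (t ^ n / INR (fact n) * (B * 2 ^ n)).
  - apply Rmult_le_compat_l; [|tauto].
    apply Rmult_le_pos; [by apply pow_le|].
    apply Rlt_le, Rinv_0_lt_compat, INR_fact_lt_0.
  - field; apply INR_fact_neq_0. }
assert (Hex : ex_series (egf t a)).
{ apply (ex_series_le (V := R_CompleteNormedModule) _ (fun n => scal B ((2 * t) ^ n / INR (fact n)))).
  - intros n; rewrite /norm /= /abs /= Rabs_pos_eq; apply Hle.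
  - by eexists; exact HB. }
split; auto; split.
- replace 0 with (Series (fun _ : nat => 0 * 0)).
  + apply Series_le; auto.
    intros n; specialize (Hle n); lra.
  + rewrite Series_scal_l; ring.
- replace (B * exp (2 * t)) with (Series (fun n => scal B ((2 * t) ^ n / INR (fact n)))).
  + apply Series_le; auto; by eexists; exact HB.
  + by apply is_series_unique.
Qed.

Lemma hcoef_shift_dom (m : nat) (d : Z) (n : nat) :
  0 <= hcoef m (d + Z.of_nat n) <= 2 ^ (m + Z.to_nat d) * 2 ^ n.
Proof.
split; [apply hcoef_ge0|].
apply Rle_trans with (1 := hcoef_bound _ _).
rewrite -pow_add; apply Rle_pow; [lra|lia].
Qed.

Lemma ex_hegf (m : nat) (d : Z) (t : R) : 0 <= t ->
  ex_series (egf t (fun n => hcoef m (d + Z.of_nat n))).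
Proof. intros Ht; eapply egf_geom_dom; auto; apply hcoef_shift_dom. Qed.

Lemma hegf_S (m : nat) (d : Z) (t : R) : 0 <= t ->
  hegf (S m) d t = hegf m d t + hegf (S m) (d - 1) t.
Proof.
intros Ht; rewrite /hegf -Series_plus; try by apply ex_hegf.
apply Series_ext; intros n; rewrite /egf hcoef_S.
replace (d + Z.of_nat n - 1)%Z with (d - 1 + Z.of_nat n)%Z by lia; ring.
Qed.

(** Lowering the index by [n] kills the terms before [n] and bounds the coefficient of the [k]-th by
    [2^m 2^(k - n)], so the whole series carries a factor [2^-n]. *)
Lemma hegf_tail (m : nat) (t : R) : 0 <= t ->
  is_lim_seq (fun n => hegf m (- Z.of_nat n) t) 0.
Proof.
intros Ht.
apply (is_lim_seq_le_le (fun _ => 0) _ (fun n => 2 ^ m * exp (2 * t) * (/ 2) ^ n)).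
- intros n.
  replace (2 ^ m * exp (2 * t) * (/ 2) ^ n) with (2 ^ m * (/ 2) ^ n * exp (2 * t)) by ring.
  apply egf_geom_dom; auto; intros k; split; [apply hcoef_ge0|].
  destruct (Nat.lt_ge_cases k n).
  + rewrite hcoef_neg; [|lia].
    repeat apply Rmult_le_pos; apply pow_le; lra.
  + apply Rle_trans with (1 := hcoef_bound _ _).
    replace k with (n + (k - n))%nat at 2 by lia.
    replace (Z.to_nat _) with (k - n)%nat by lia.
    rewrite !pow_add.
    apply Req_le; transitivity (2 ^ m * ((/ 2 * 2) ^ n * 2 ^ (k - n))).
    * rewrite Rinv_l ?pow1; [ring|lra].
    * rewrite Rpow_mult_distr; ring.
- apply is_lim_seq_const.
- replace 0 with (2 ^ m * exp (2 * t) * 0) by ring.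
  apply is_lim_seq_mult'; [apply is_lim_seq_const|].
  apply is_lim_seq_geom; rewrite Rabs_pos_eq; lra.
Qed.

(** Cauchy product, where the factorials combine into binomials. Nonnegative terms supply the
    absolute convergence it requires. *)
Lemma is_series_egf_mul (t la lb : R) (a b : nat -> R) : 0 <= t ->
  (forall n, 0 <= a n) -> (forall n, 0 <= b n) ->
  is_series (egf t a) la -> is_series (egf t b) lb ->
  is_series (egf t (fun n => sum_f_R0 (fun k => Binomial.C n k * (a k * b (n - k)%nat)) n))
    (la * lb).
Proof.
intros Ht Ha Hb Sa Sb.
eapply is_series_ext; [|apply (is_series_mult _ _ _ _ Sa Sb)].
- intros n; rewrite /= /egf scal_sum; apply sum_eq; intros k Hk.
  replace (t ^ n) with (t ^ k * t ^ (n - k)) by (rewrite -pow_add; f_equal; lia).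
  rewrite /Binomial.C; field; repeat split; apply INR_fact_neq_0.
- eapply ex_series_ext; [|by eexists; exact Sa].
  by intros n; rewrite /= Rabs_pos_eq //; apply egf_ge0.
- eapply ex_series_ext; [|by eexists; exact Sb].
  by intros n; rewrite /= Rabs_pos_eq //; apply egf_ge0.
Qed.

(** * Laurent coefficients of the one-variable integrand *)

Definition is_cderive (f : R -> C) (s : R) (l : C) : Prop :=
  is_derive (fun s => Re (f s)) s (Re l) /\ is_derive (fun s => Im (f s)) s (Im l).

Lemma is_cderive_mul (f g : R -> C) (s : R) (a b : C) :
  is_cderive f s a -> is_cderive g s b ->
  is_cderive (fun s => Cmul (f s) (g s)) s (Cadd (Cmul a (g s)) (Cmul (f s) b)).
Proof.
intros [H1 H2] [H3 H4]; split; simpl.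
- evar_last.
  + apply: is_derive_minus; apply: is_derive_mult; eauto; intros; apply Rmult_comm.
  + rewrite /minus /plus /opp /mult /=; ring.
- evar_last.
  + apply: is_derive_plus; apply: is_derive_mult; eauto; intros; apply Rmult_comm.
  + rewrite /minus /plus /opp /mult /=; ring.
Qed.

Lemma is_cderive_add (f g : R -> C) (s : R) (a b : C) :
  is_cderive f s a -> is_cderive g s b ->
  is_cderive (fun s => Cadd (f s) (g s)) s (Cadd a b).
Proof. intros [] []; split; simpl; by apply: is_derive_plus. Qed.

Lemma is_cderive_mul_RtoC (w : C) (f : R -> R) (s l : R) :
  is_derive f s l -> is_cderive (fun s => Cmul w (RtoC (f s))) s (Cmul w (RtoC l)).
Proof.
intros H; split; simpl.
- apply (is_derive_ext (fun s => Re w * f s)); [intros; simpl; ring|].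
  replace (_ - _) with (Re w * l) by ring; by apply: is_derive_scal.
- apply (is_derive_ext (fun s => Im w * f s)); [intros; simpl; ring|].
  replace (_ + _) with (Im w * l) by ring; by apply: is_derive_scal.
Qed.

Lemma is_cderive_exp (w : C) (s : R) :
  is_cderive (fun s => Cexp (Cmul w (RtoC s))) s (Cmul w (Cexp (Cmul w (RtoC s)))).
Proof.
assert (E : forall s, Cmul w (RtoC s) = mkC (Re w * s) (Im w * s)).
{ intros u; apply C_ext; simpl; ring. }
split; rewrite E.
- apply (is_derive_ext (fun s => exp (Re w * s) * cos (Im w * s))).
  + intros u; by rewrite E.
  + auto_derive; auto; simpl; ring.
- apply (is_derive_ext (fun s => exp (Re w * s) * sin (Im w * s))).
  + intros u; by rewrite E.
  + auto_derive; auto; simpl; ring.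
Qed.

Lemma Cexp_add (z w : C) : Cexp (Cadd z w) = Cmul (Cexp z) (Cexp w).
Proof. apply C_ext; simpl; rewrite exp_plus ?cos_plus ?sin_plus; ring. Qed.

Lemma cnorm_exp (z : C) : cnorm (Cexp z) = exp (Re z).
Proof. apply (cnorm_circ (exp (Re z)) (Im z)), Rlt_le, exp_pos. Qed.

Lemma cnorm_exp_le (z : C) (B : R) : cnorm z <= B -> cnorm (Cexp z) <= exp B.
Proof.
intros H; rewrite cnorm_exp.
pose proof (Re_le_cnorm z); pose proof (Rle_abs (Re z)).
destruct (Rle_lt_or_eq_dec (Re z) B) as [| ->]; [lra| |apply Rle_refl].
by apply Rlt_le, exp_increasing.
Qed.

(** The mean value theorem fails for complex values, so it is applied to [Re] and [Im] separately;
    hence the factor 2. *)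
Lemma cmean_value (f f' : R -> C) (B : R) :
  (forall s, 0 <= s <= 1 -> is_cderive f s (f' s) /\ cnorm (f' s) <= B) ->
  cnorm (Csub (f 1) (f 0)) <= 2 * B.
Proof.
intros H.
assert (HR : forall (p : C -> R), (forall z, Rabs (p z) <= cnorm z) ->
  (forall s, 0 <= s <= 1 -> is_derive (fun s => p (f s)) s (p (f' s))) ->
  Rabs (p (f 1) - p (f 0)) <= B).
{ intros p Hp Hd.
  destruct (MVT_gen (fun s => p (f s)) 0 1 (fun s => p (f' s))) as [c [Hc Heq]].
  - rewrite Rmin_left ?Rmax_right; try lra; intros; apply Hd; lra.
  - rewrite Rmin_left ?Rmax_right; try lra; intros s Hs.
    apply continuity_pt_filterlim; apply: ex_derive_continuous.
    by eexists; apply Hd.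
  - rewrite Rmin_left ?Rmax_right in Hc; try lra.
    rewrite Heq Rminus_0_r Rmult_1_r.
    apply Rle_trans with (1 := Hp _); by apply H. }
apply Rle_trans with (1 := cnorm_le_parts _).
assert (H1 : Rabs (Re (f 1) - Re (f 0)) <= B).
{ apply HR; [apply Re_le_cnorm|]; intros s Hs; apply H, Hs. }
assert (H2 : Rabs (Im (f 1) - Im (f 0)) <= B).
{ apply HR; [apply Im_le_cnorm|]; intros s Hs; apply H, Hs. }
rewrite /= -!/(Rminus _ _); lra.
Qed.

(** The scalar [s] runs along the segment from 0 to [w], so that the remainder of the complex
    exponential can be estimated through a derivative in one real variable. *)
Definition cexp_trunc (w : C) (K : nat) (s : R) : C :=
  csum (fun n => Cmul (Cpow w n) (RtoC (s ^ n / INR (fact n)))) K.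

Lemma is_cderive_exp_trunc (w : C) (K : nat) (s : R) :
  is_cderive (cexp_trunc w (S K)) s (Cmul w (cexp_trunc w K s)).
Proof.
induction K as [|K IH].
- split; rewrite /cexp_trunc /=.
  + apply (is_derive_ext (fun _ => 1)); [intros; simpl; field|].
    replace (_ - _) with 0 by ring; apply: is_derive_const.
  + apply (is_derive_ext (fun _ => 0)); [intros; simpl; field|].
    replace (_ + _) with 0 by ring; apply: is_derive_const.
- change (cexp_trunc w (S (S K))) with
    (fun s => Cadd (cexp_trunc w (S K) s) (Cmul (Cpow w (S K)) (RtoC (s ^ (S K) / INR (fact (S K)))))).
  replace (Cmul w (cexp_trunc w (S K) s)) with
    (Cadd (Cmul w (cexp_trunc w K s)) (Cmul (Cpow w (S K)) (RtoC (s ^ K / INR (fact K))))).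
  + apply is_cderive_add; auto.
    apply is_cderive_mul_RtoC.
    apply (is_derive_ext (fun u => / INR (fact (S K)) * u ^ S K)).
    { intros u; apply Rmult_comm. }
    replace (s ^ K / INR (fact K)) with (/ INR (fact (S K)) * (INR (S K) * s ^ K)).
    * apply: is_derive_scal; evar_last; [apply: is_derive_pow; apply: is_derive_id|].
      rewrite /one [Nat.pred _]/=; simpl; ring.
    * rewrite fact_simpl mult_INR; field; split; [apply INR_fact_neq_0|].
      by apply not_0_INR.
  + rewrite /cexp_trunc /=; ring.
Qed.

(** The derivative of [e^{-sw} sum_{n<=K} (sw)^n/n!] telescopes to the single
    term [- w e^{-sw} (sw)^K/K!]. *)
Lemma cexp_trunc_bound (w : C) (K : nat) (B : R) : cnorm w <= B ->
  cnorm (Csub (Cexp w) (cexp_trunc w (S K) 1)) <= 2 * exp B * exp B * B * (B ^ K / INR (fact K)).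
Proof.
intros HB; pose proof (cnorm_ge0 w).
set phi := fun s => Cmul (Cexp (Cmul (Copp w) (RtoC s))) (cexp_trunc w (S K) s).
assert (H0 : phi 0 = C1).
{ rewrite /phi; replace (Cmul (Copp w) (RtoC 0)) with C0; last (apply C_ext; simpl; ring).
  replace (Cexp C0) with C1; last (apply C_ext; rewrite /= exp_0 ?cos_0 ?sin_0; ring).
  clear; induction K as [|K IH].
  - rewrite /cexp_trunc /=; apply C_ext; simpl; field.
  - change (cexp_trunc w (S (S K)) 0) with
     (Cadd (cexp_trunc w (S K) 0) (Cmul (Cpow w (S K)) (RtoC (0 ^ (S K) / INR (fact (S K)))))).
    replace (RtoC (0 ^ (S K) / INR (fact (S K)))) with C0.
    + transitivity (Cmul C1 (cexp_trunc w (S K) 0)); [ring|exact IH].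
    + rewrite pow_i; [|lia]; rewrite /C0; f_equal; rewrite /Rdiv; ring. }
assert (Hb : cnorm (Csub (phi 1) (phi 0)) <= 2 * (exp B * B * (B ^ K / INR (fact K)))).
{ apply (cmean_value _ (fun s => Cmul (Cexp (Cmul (Copp w) (RtoC s)))
     (Copp (Cmul w (Cmul (Cpow w K) (RtoC (s ^ K / INR (fact K)))))))).
  intros s Hs; split.
  - pose proof (is_cderive_mul _ _ s _ _ (is_cderive_exp (Copp w) s) (is_cderive_exp_trunc w K s)) as Hd.
    replace (Cmul (Cexp _) _) with (Cadd
     (Cmul (Cmul (Copp w) (Cexp (Cmul (Copp w) (RtoC s)))) (cexp_trunc w (S K) s))
     (Cmul (Cexp (Cmul (Copp w) (RtoC s))) (Cmul w (cexp_trunc w K s)))); auto.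
    rewrite /cexp_trunc [csum _ (S K)]/=; ring.
  - rewrite cnorm_mul cnorm_opp !cnorm_mul cnorm_pow cnorm_RtoC.
    assert (Hs1 : 0 <= s ^ K <= 1).
    { split; [apply pow_le; lra|]. rewrite -(pow1 K); apply pow_incr; lra. }
    pose proof (INR_fact_lt_0 K) as HK.
    assert (HiK : 0 < / INR (fact K)) by (by apply Rinv_0_lt_compat).
    rewrite Rabs_pos_eq; last (apply Rmult_le_pos; lra).
    rewrite Rmult_assoc.
    assert (0 <= cnorm w ^ K <= B ^ K).
    { split; [by apply pow_le|by apply pow_incr]. }
    apply Rmult_le_compat; [apply cnorm_ge0| | |].
    + repeat apply Rmult_le_pos; lra.
    + apply cnorm_exp_le; rewrite cnorm_mul cnorm_opp cnorm_RtoC Rabs_pos_eq; [nra|lra].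
    + apply Rmult_le_compat; try lra.
      * apply Rmult_le_pos; [lra|]. apply Rmult_le_pos; lra.
      * apply Rmult_le_compat; try lra. 
        -- apply Rmult_le_pos; lra.
        -- rewrite /Rdiv; nra. }
(* Multiplying by [e^w] undoes the factor [e^(-w)] of [phi 1], and [phi 0 = 1]. *)
replace (Csub _ _) with (Cmul (Cexp w) (Copp (Csub (phi 1) (phi 0)))).
- rewrite cnorm_mul cnorm_opp.
  pose proof (cnorm_exp_le w B HB); pose proof (cnorm_ge0 (Cexp w)).
  pose proof (cnorm_ge0 (Csub (phi 1) (phi 0))).
  replace (2 * exp B * exp B * B * (B ^ K / INR (fact K))) with
    (exp B * (2 * (exp B * B * (B ^ K / INR (fact K))))) by ring.
  by apply Rmult_le_compat.
- rewrite H0 /phi.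
  transitivity (Csub (Cexp w) (Cmul (Cmul (Cexp w) (Cexp (Cmul (Copp w) (RtoC 1)))) (cexp_trunc w (S K) 1))); [ring|].
  rewrite -Cexp_add.
  replace (Cadd w _) with C0; last by apply C_ext; simpl; ring.
  replace (Cexp C0) with C1; last by apply C_ext; rewrite /= exp_0 ?cos_0 ?sin_0; ring.
  ring.
Qed.

Lemma mean_csum (r : R) (g : nat -> C -> C) (c : nat -> C) (K : nat) :
  (forall n, mean r (g n) (c n)) ->
  mean r (fun z => csum (fun n => g n z) K) (csum c K).
Proof.
intros H; induction K as [|K IH]; simpl.
(* The mean of the zero function, obtained as 0 times that of [g 0]. *)
- pose proof (mean_scal r C0 _ _ (H 0%nat)) as H0.
  replace (Cmul C0 (c 0%nat)) with C0 in H0 by ring.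
  eapply mean_ext; [|exact H0]; intros u; apply C_ext; simpl; ring.
- by apply mean_add.
Qed.

Lemma csum_RtoC (a : nat -> R) (K : nat) :
  csum (fun n => RtoC (a n)) (S K) = RtoC (sum_n a K).
Proof.
induction K as [|K IH].
- rewrite sum_O /=; apply C_ext; simpl; ring.
- rewrite sum_Sn [csum _ _]/= -[Cadd (csum _ _) _]/(csum _ (S K)) IH.
  apply C_ext; rewrite /plus /=; ring.
Qed.

(** Of the terms [z^(q - n) t^n / n!] only [n = q] has a nonzero mean, and [hcoef 0 (n - q)] is this
    Kronecker delta. *)
Lemma mean_exp (r t : R) (q : Z) : 0 < r -> 0 <= t ->
  mean r (fun z => Cmul (CpowZ z q) (Cexp (Cmul (Cinv z) (RtoC t))))
    (RtoC (hegf 0 (- q) t)).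
Proof.
intros Hr Ht; apply mean_uniform; intros eps Heps.
(* The bound of [cexp_trunc_bound] at [|t/z| = t / r], uniform on the circle. *)
assert (Hb : is_lim_seq (fun K => powerRZ r q * (2 * exp (t / r) * exp (t / r) * (t / r) *
   ((t / r) ^ K / INR (fact K)))) 0).
{ replace 0 with (powerRZ r q * (2 * exp (t / r) * exp (t / r) * (t / r) * 0)) by ring.
  apply is_lim_seq_mult'; [apply is_lim_seq_const|].
  apply is_lim_seq_mult'; [apply is_lim_seq_const|].
  apply is_lim_seq_Reals, cv_speed_pow_fact. }
apply is_lim_seq_spec in Hb; destruct (Hb (mkposreal _ Heps)) as [K1 HK1].
pose proof (Series_correct _ (ex_hegf 0 (- q) t Ht)) as Hs.
assert (Hs' : is_lim_seq (sum_n (egf t (fun n => hcoef 0 (- q + Z.of_nat n)))) (hegf 0 (- q) t))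
  by exact Hs.
apply is_lim_seq_spec in Hs'; destruct (Hs' (mkposreal _ Heps)) as [K2 HK2].
set K := Nat.max K1 K2.
specialize (HK1 K ltac:(lia)); specialize (HK2 K ltac:(lia)); simpl in HK1, HK2.
exists (fun z => Cmul (CpowZ z q) (cexp_trunc (Cmul (Cinv z) (RtoC t)) (S K) 1)).
exists (RtoC (sum_n (egf t (fun n => hcoef 0 (- q + Z.of_nat n))) K)).
split; [|split].
- intros u.
  match goal with |- cnorm ?X <= _ => replace X with
    (Cmul (CpowZ (circ r u) q) (Csub (Cexp (Cmul (Cinv (circ r u)) (RtoC t)))
      (cexp_trunc (Cmul (Cinv (circ r u)) (RtoC t)) (S K) 1))) by ring end.
  rewrite cnorm_mul cnorm_circ_powZ //.
  apply Rle_trans with (2 := Rlt_le _ _ HK1).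
  rewrite Rminus_0_r; apply Rle_trans with (2 := Rle_abs _).
  apply Rmult_le_compat_l; [by apply powerRZ_le|].
  apply cexp_trunc_bound.
  rewrite circ_inv; [|lra]; rewrite -circ_0 circ_mul cnorm_circ; [right; field; lra|].
  apply Rmult_le_pos; [|lra]; apply Rlt_le, Rinv_0_lt_compat, Hr.
- replace (Csub _ _) with (RtoC (sum_n (egf t (fun n => hcoef 0 (- q + Z.of_nat n))) K - hegf 0 (- q) t)).
  + rewrite cnorm_RtoC; lra.
  + apply C_ext; simpl; ring.
- rewrite -csum_RtoC.
  apply (mean_ext r (fun z => csum (fun n =>
     Cmul (RtoC (t ^ n / INR (fact n))) (CpowZ z (q - Z.of_nat n))) (S K))).
  + intros u; rewrite /cexp_trunc -csum_mul; apply csum_ext; intros n _.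
    rewrite circ_inv; [|lra].
    rewrite -!circ_0 circ_mul circ_pow !circ_powZ; try lra.
    rewrite !circ_mul; f_equal.
    * rewrite powerRZ_add; [|lra]; rewrite powerRZ_neg'; rewrite -pow_powerRZ Rpow_mult_distr pow1 pow_inv.
      field; split; [apply INR_fact_neq_0|]; apply pow_nonzero; lra.
    * rewrite minus_IZR -INR_IZR_INZ; ring.
  + apply mean_csum; intros n.
    replace (RtoC (egf _ _ n)) with (Cmul (RtoC (t ^ n / INR (fact n)))
      (if (q - Z.of_nat n =? 0)%Z then C1 else C0)).
    * by apply mean_scal, mean_powZ.
    * rewrite /egf; destruct (Z.eqb_spec (q - Z.of_nat n) 0).
      -- replace (- q + Z.of_nat n)%Z with 0%Z by lia; rewrite hcoef_0.
         apply C_ext; simpl; ring.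
      -- replace (hcoef 0 _) with 0; [apply C_ext; simpl; ring|].
         destruct (Z.lt_trichotomy (- q + Z.of_nat n) 0) as [|[|]]; [|lia|].
         ++ by rewrite hcoef_neg.
         ++ by rewrite hcoef_pos0.
Qed.

Lemma cnorm_1_sub (r u : R) : 0 < r -> 1 - r <= cnorm (Csub C1 (circ r u)).
Proof.
intros Hr.
pose proof (cnorm_add (Csub C1 (circ r u)) (circ r u)) as H.
replace (Cadd _ _) with C1 in H by ring.
rewrite {1}/C1 cnorm_RtoC Rabs_R1 (cnorm_circ r) in H; lra.
Qed.

Lemma C1_sub_circ_neq0 (r u : R) : 0 < r < 1 -> Csub C1 (circ r u) <> C0.
Proof.
intros Hr H; pose proof (cnorm_1_sub r u (proj1 Hr)) as H1.
rewrite H cnorm_C0 in H1; lra.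
Qed.

(** Its mean is the coefficient of [z^(-q)] in [(1 - z)^-m e^(t/z)]. *)
Definition laurent (m : nat) (q : Z) (t : R) (z : C) : C :=
  Cmul (CpowZ z q) (Cmul (Cpow (Cinv (Csub C1 z)) m) (Cexp (Cmul (Cinv z) (RtoC t)))).

(** From [1/(1 - z) = 1 + z/(1 - z)]; the counterpart of [hegf_S]. *)
Lemma laurent_S (m : nat) (q : Z) (t r u : R) : 0 < r < 1 ->
  laurent (S m) q t (circ r u)
  = Cadd (laurent m q t (circ r u)) (laurent (S m) (q + 1) t (circ r u)).
Proof.
intros Hr.
pose proof (Cmul_inv _ (C1_sub_circ_neq0 r u Hr)) as HI.
rewrite /laurent -circ_powZ_add; [|lra]; simpl Cpow.
set z := circ r u in HI *; set I := Cinv (Csub C1 z) in HI *.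
assert (E : I = Cadd C1 (Cmul z I)) by (rewrite -HI; ring).
change (CpowZ z 1) with (Cmul z C1).
rewrite {1}E; ring.
Qed.

Lemma laurent_iter (m : nat) (q : Z) (t r u : R) (K : nat) : 0 < r < 1 ->
  laurent (S m) q t (circ r u) =
  Cadd (csum (fun a => laurent m (q + Z.of_nat a) t (circ r u)) K)
       (laurent (S m) (q + Z.of_nat K) t (circ r u)).
Proof.
intros Hr; induction K as [|K IH].
- rewrite /= Z.add_0_r; ring.
- rewrite IH laurent_S // [csum _ (S K)]/=.
  replace (q + Z.of_nat K + 1)%Z with (q + Z.of_nat (S K))%Z by lia; ring.
Qed.

Lemma cnorm_laurent (m : nat) (q : Z) (t r u : R) : 0 < r < 1 -> 0 <= t ->
  cnorm (laurent m q t (circ r u)) <= powerRZ r q * ((/ (1 - r)) ^ m * exp (t / r)).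
Proof.
intros Hr Ht; rewrite /laurent !cnorm_mul cnorm_circ_powZ; [|lra].
apply Rmult_le_compat_l; [apply powerRZ_le; lra|].
apply Rmult_le_compat; try apply cnorm_ge0.
- rewrite cnorm_pow cnorm_inv; [|by apply C1_sub_circ_neq0].
  pose proof (cnorm_1_sub r u (proj1 Hr)).
  apply pow_incr; split; [apply Rlt_le, Rinv_0_lt_compat; lra|].
  apply Rinv_le_contravar; lra.
- apply cnorm_exp_le; rewrite circ_inv; [|lra].
  rewrite -circ_0 circ_mul cnorm_circ; [right; field; lra|].
  apply Rmult_le_pos; [|lra]; apply Rlt_le, Rinv_0_lt_compat; lra.
Qed.

Lemma hegf_iter (m : nat) (q : Z) (t : R) (K : nat) : 0 <= t ->
  RtoC (hegf (S m) (- q) t) =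
  Cadd (csum (fun a => RtoC (hegf m (- (q + Z.of_nat a)) t)) K)
       (RtoC (hegf (S m) (- (q + Z.of_nat K)) t)).
Proof.
intros Ht; induction K as [|K IH].
- rewrite /= Z.add_0_r; ring.
- rewrite IH (hegf_S m (- (q + Z.of_nat K))) // [csum _ (S K)]/=.
  replace (- (q + Z.of_nat K) - 1)%Z with (- (q + Z.of_nat (S K)))%Z by lia.
  apply C_ext; simpl; ring.
Qed.

(** Peeling [K] terms off one geometric series leaves terms of exponent [m], covered by induction,
    and remainders of the same shape on both sides: of order [r^K] uniformly on the circle, and
    vanishing by [hegf_tail] for the coefficients. *)
Lemma mean_laurent (m : nat) (q : Z) (t r : R) : 0 < r < 1 -> 0 <= t ->
  mean r (laurent m q t) (RtoC (hegf m (- q) t)).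
Proof.
intros Hr Ht; revert q; induction m as [|m IH]; intros q.
- eapply mean_ext; [|apply mean_exp; [apply Hr|exact Ht]].
  intros u; rewrite /laurent /=; ring.
- apply mean_uniform; intros eps Heps.
  assert (Hb : is_lim_seq (fun K => powerRZ r q * ((/ (1 - r)) ^ S m * exp (t / r)) * r ^ K) 0).
  { replace 0 with (powerRZ r q * ((/ (1 - r)) ^ S m * exp (t / r)) * 0) by ring.
    apply is_lim_seq_mult'; [apply is_lim_seq_const|].
    apply is_lim_seq_geom; rewrite Rabs_pos_eq; lra. }
  apply is_lim_seq_spec in Hb; destruct (Hb (mkposreal _ Heps)) as [K1 HK1].
  pose proof (hegf_tail (S m) t Ht) as Hs.
  apply is_lim_seq_spec in Hs; destruct (Hs (mkposreal _ Heps)) as [K2 HK2].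
  (* The summand [|q|] makes [q + K] nonnegative and at least [K2]. *)
  set K := (K1 + K2 + Z.to_nat (Z.abs q))%nat.
  specialize (HK1 K ltac:(lia)).
  specialize (HK2 (Z.to_nat (q + Z.of_nat K)) ltac:(lia)); cbn beta in HK1, HK2.
  rewrite Z2Nat.id in HK2; [|lia].
  exists (fun z => csum (fun a => laurent m (q + Z.of_nat a) t z) K).
  exists (csum (fun a => RtoC (hegf m (- (q + Z.of_nat a)) t)) K).
  split; [|split].
  + intros u; rewrite (laurent_iter _ _ _ _ _ K Hr).
    match goal with |- cnorm ?X <= _ => replace X with
      (laurent (S m) (q + Z.of_nat K) t (circ r u)) by ring end.
    apply Rle_trans with (1 := cnorm_laurent _ _ _ _ _ Hr Ht).
    apply Rle_trans with (2 := Rlt_le _ _ HK1).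
    rewrite Rminus_0_r; apply Rle_trans with (2 := Rle_abs _).
    rewrite powerRZ_add; [|lra]; rewrite -pow_powerRZ; right; ring.
  + rewrite (hegf_iter m q t K Ht).
    match goal with |- cnorm ?X <= _ => replace X with
      (Copp (RtoC (hegf (S m) (- (q + Z.of_nat K)) t))) by ring end.
    rewrite cnorm_opp cnorm_RtoC; rewrite Rminus_0_r in HK2; simpl in HK2; lra.
  + by apply mean_csum.
Qed.

(** Since [d xi = i z d theta], the exponent [p + j] gains 1; and [veps z = 1/z - 1] splits off
    [e^(-t)]. *)
Lemma contour_riemann (m : nat) (p : Z) (j : nat) (t r : R) : 0 < r < 1 -> 0 <= t ->
  clim (fun M => csum (fun l =>
      let z := circ r (2 * PI / INR M * INR l) in
      Cmul (Cmul (RtoC (2 * PI / INR M)) (Cmul Ci z))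
        (Cmul (Cpow z j) (Cmul (Cpow (Cinv (Csub C1 z)) m)
          (Cmul (CpowZ z p) (Cexp (Cmul (veps z) (RtoC t))))))) M)
    (Cmul (Cmul (RtoC (2 * PI)) Ci) (RtoC (exp (- t) * hegf m (- (p + Z.of_nat j + 1)) t))).
Proof.
intros Hr Ht.
pose proof (mean_laurent m (p + Z.of_nat j + 1) t r Hr Ht) as H.
pose proof (clim_mul _ _ _ _ (clim_const (Cmul (Cmul (RtoC (2 * PI)) Ci) (RtoC (exp (- t))))) H) as H1.
replace (RtoC (exp (- t) * _)) with (Cmul (RtoC (exp (- t))) (RtoC (hegf m (- (p + Z.of_nat j + 1)) t)));
  last by apply C_ext; simpl; ring.
replace (Cmul _ (Cmul (RtoC (exp (- t))) _)) with
  (Cmul (Cmul (Cmul (RtoC (2 * PI)) Ci) (RtoC (exp (- t)))) (RtoC (hegf m (- (p + Z.of_nat j + 1)) t))) by ring.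
eapply clim_ext; [|exact H1].
intros M; rewrite /average -!csum_mul; apply csum_ext; intros l _.
set u := 2 * PI / INR M * INR l; cbn zeta.
rewrite /laurent -!circ_powZ_add; try lra.
replace (CpowZ (circ r u) (Z.of_nat j)) with (Cpow (circ r u) j); last first.
{ rewrite circ_powZ ?circ_pow; [|lra]. by rewrite -pow_powerRZ -INR_IZR_INZ. }
replace (Cexp (Cmul (veps (circ r u)) (RtoC t))) with
  (Cmul (Cexp (Cmul (Cinv (circ r u)) (RtoC t))) (RtoC (exp (- t)))); last first.
{ replace (Cmul (veps _) _) with (Cadd (Cmul (Cinv (circ r u)) (RtoC t)) (RtoC (- t))).
  - rewrite Cexp_add; f_equal; apply C_ext; simpl; rewrite ?cos_0 ?sin_0; ring.
  - transitivity (Cadd (Cmul (Cinv (circ r u)) (RtoC t)) (Copp (RtoC t))).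
    + f_equal; apply C_ext; simpl; ring.
    + rewrite /veps; ring. }
replace (RtoC (2 * PI / INR M)) with (Cmul (RtoC (2 * PI)) (RtoC (/ INR M))); last first.
{ apply C_ext; simpl; rewrite /Rdiv; ring. }
change (CpowZ (circ r u) 1) with (Cmul (circ r u) C1).
ring.
Qed.

(** * Jumps of the particle system *)

Fixpoint bump_at (i : nat) (Y : list Z) : list Z :=
  match Y, i with
  | [], _ => []
  | y :: Y', O => Z.succ y :: Y'
  | y :: Y', S i' => y :: bump_at i' Y'
  end.

Lemma length_bump_at (i : nat) (Y : list Z) : length (bump_at i Y) = length Y.
Proof. revert i; induction Y as [|y Y IH]; intros [|i]; simpl; auto. Qed.

Lemma nth_bump_at (i j : nat) (Y : list Z) : (i < length Y)%nat ->
  nth j (bump_at i Y) 0%Z = if Nat.eqb j i then Z.succ (nth j Y 0%Z) else nth j Y 0%Z.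
Proof.
revert i j; induction Y as [|y Y IH]; intros [|i] [|j] Hi; simpl in *; try lia; auto.
apply IH; lia.
Qed.

Lemma jump_free (i : nat) (Y : list Z) (L : list nat) :
  length Y = length L -> (i < length Y)%nat ->
  ((S i < length Y)%nat -> nth (S i) Y 0%Z <> Z.succ (nth i Y 0%Z)) ->
  jump i (combine Y L) = combine (bump_at i Y) L.
Proof.
revert i L; induction Y as [|y Y IH]; intros i [|a L] HL Hi Hn; simpl in *; try lia.
destruct i as [|i]; simpl.
- destruct Y as [|z Y], L as [|b L]; simpl in *; try lia; auto.
  destruct (Z.eqb_spec z (y + 1)); auto.
  exfalso; apply Hn; lia.
- f_equal; apply IH; lia.
Qed.

Lemma jump_blocked (i : nat) (Y : list Z) (L : list nat) :
  length Y = length L -> (S i < length Y)%nat ->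
  nth (S i) Y 0%Z = Z.succ (nth i Y 0%Z) -> nth i L 0%nat = nth (S i) L 0%nat ->
  jump i (combine Y L) = combine Y L.
Proof.
revert i L; induction Y as [|y Y IH]; intros i [|a L] HL Hi Hn Ha; simpl in *; try lia.
destruct i as [|i]; simpl.
- destruct Y as [|z Y], L as [|b L]; simpl in *; try lia; auto; subst a.
  destruct (Z.eqb_spec z (y + 1)); [|lia].
  destruct (Nat.eqb_spec b 2), (Nat.eqb_spec b 1); simpl; auto; lia.
- f_equal; apply IH; auto; lia.
Qed.

Fixpoint firsts (k : nat) (s : state) : nat :=
  match k, s with
  | S k', (_, a) :: s' => ((if Nat.eqb a 2 then 1 else 0) + firsts k' s')%nat
  | _, _ => 0%nat
  end.

Lemma firsts_jump (k i : nat) (s : state) : (firsts k (jump i s) <= firsts k s)%nat.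
Proof.
revert k i; induction s as [|[y a] s IH]; intros [|k] i; try (simpl; lia);
  try (destruct i; simpl; lia).
- destruct i as [|i]; [|simpl; specialize (IH k i); lia].
  destruct s as [|[z b] s]; cbn [jump]; [simpl; lia|].
  destruct (Z.eqb_spec z (y + 1)); [|simpl; lia].
  destruct (Nat.eqb a 2 && Nat.eqb b 1)%bool eqn:E; [|lia].
  apply andb_prop in E; destruct E as [Ha Hb].
  apply Nat.eqb_eq in Ha; apply Nat.eqb_eq in Hb; subst a b.
  destruct k; simpl; lia.
Qed.

(** After the exchange the label at index [i] is 1, so at most [i] of the first [i + 1] labels are
    2. *)
Lemma firsts_exchange (i : nat) (Y : list Z) (L : list nat) :
  length Y = length L -> (S i < length Y)%nat ->
  nth (S i) Y 0%Z = Z.succ (nth i Y 0%Z) -> nth i L 0%nat = 2%nat -> nth (S i) L 0%nat = 1%nat ->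
  (firsts (S i) (jump i (combine Y L)) < S i)%nat.
Proof.
revert i L; induction Y as [|y Y IH]; intros i [|a L] HL Hi Hn Ha Hb; simpl in *; try lia.
destruct i as [|i].
- destruct Y as [|z Y], L as [|b L]; simpl in *; try lia; subst a b.
  destruct (Z.eqb_spec z (y + 1)); [|lia]; simpl; lia.
- specialize (IH i L ltac:(lia) ltac:(lia) Hn Ha Hb).
  cbn [jump firsts]; destruct (Nat.eqb a 2); lia.
Qed.

Lemma firsts_labels (k : nat) (s : state) (L : list nat) :
  map snd s = repeat 2%nat k ++ L -> firsts k s = k.
Proof.
revert s; induction k as [|k IH]; intros [|[z a] s] H; simpl in *; auto; try discriminate.
injection H as -> H; rewrite (IH s H) //.
Qed.

Lemma event_E_firsts (N k : nat) (x : Z) (s : state) :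
  event_E N k x s = true -> firsts k s = k.
Proof.
rewrite /event_E /list_nat_eqb.
destruct k as [|k]; [by destruct s as [|[]]|].
destruct (list_eq_dec _ _ _) as [e|]; [|discriminate].
intros _; exact (firsts_labels _ _ _ e).
Qed.

(** Label-2 particles only overtake to the right, so the number of 2s among the
    first [k] labels never increases: after one exchange [nu k] is lost for good. *)
Lemma count_paths_dead (N k : nat) (x : Z) (n : nat) (s : state) :
  (firsts k s < k)%nat -> count_paths N (event_E N k x) n s = 0.
Proof.
revert s; induction n as [|n IH]; intros s Hs.
- simpl; destruct (event_E N k x s) eqn:E; auto.
  apply event_E_firsts in E; lia.
- cbn [count_paths]; generalize (seq 0 N) as l; induction l as [|i l IHl]; simpl; auto.
  rewrite IHl IH; [ring|].
  apply Nat.le_lt_trans with (2 := Hs), firsts_jump.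
Qed.

Lemma length_nu (N k : nat) : (k <= N)%nat -> length (nu N k) = N.
Proof. intros H; rewrite /nu length_app !repeat_length; lia. Qed.

Lemma nth_nu_first (N k i : nat) : (i < k)%nat -> nth i (nu N k) 0%nat = 2%nat.
Proof.
intros H; rewrite /nu app_nth1 ?repeat_length; [|lia].
by apply nth_repeat_lt.
Qed.

Lemma nth_nu_second (N k i : nat) : (k <= i < N)%nat -> nth i (nu N k) 0%nat = 1%nat.
Proof.
intros H; rewrite /nu app_nth2 ?repeat_length; [|lia].
apply nth_repeat_lt; lia.
Qed.

Lemma event_E_init (N k : nat) (x : Z) (Y : list Z) :
  (k <= N)%nat -> length Y = N ->
  event_E N k x (combine Y (nu N k)) =
  match k with
  | O => (x <=? nth 0 Y 0)%Z
  | S _ => forallb (fun j => Z.eqb (nth j Y 0%Z) (x + Z.of_nat j)%Z) (seq 0 k)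
  end.
Proof.
intros Hk HY.
assert (HL : length Y = length (nu N k)) by (by rewrite length_nu).
assert (Hfst : map fst (combine Y (nu N k)) = Y).
{ revert HL; generalize (nu N k); clear.
  induction Y as [|y Y IH]; intros [|a L] H; simpl in *; auto; try discriminate.
  f_equal; apply IH; congruence. }
assert (Hsnd : map snd (combine Y (nu N k)) = nu N k).
{ revert HL; generalize (nu N k); clear.
  induction Y as [|y Y IH]; intros [|a L] H; simpl in *; auto; try discriminate.
  f_equal; apply IH; congruence. }
rewrite /event_E Hfst Hsnd /list_nat_eqb.
destruct k; (destruct (list_eq_dec _ _ _); [auto|contradiction]).
Qed.

Lemma is_series_single : is_series (fun n => match n with O => 1 | S _ => 0 end) 1.
Proof.
apply (is_lim_seq_ext (fun _ => 1) _ 1); [|apply is_lim_seq_const].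
intros n; induction n as [|n IH]; [by rewrite sum_O|].
rewrite sum_Sn -IH /plus /=; ring.
Qed.

Lemma Sorted_nth (Y : list Z) (i : nat) : Sorted Z.lt Y -> (S i < length Y)%nat ->
  (nth i Y 0 < nth (S i) Y 0)%Z.
Proof.
intros H; revert i; induction H as [|y Y HY IH Hd]; intros i Hi; simpl in *; [lia|].
destruct i as [|i]; [|apply IH; lia].
destruct Hd; simpl in *; [lia|auto].
Qed.

End Analysis.

Module Determinants.
Import FunctionalExtensionality.
Import all_boot all_order all_fingroup all_algebra zify.
Set Implicit Arguments. Unset Strict Implicit. Unset Printing Implicit Defensive.
Import GRing.Theory Num.Theory.
Local Open Scope ring_scope.

(** * The free evolution and its boundary conditions *)

Definition right1 n (y : 'I_n -> Z) (i : 'I_n) : 'I_n -> Z :=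
  fun j => if j == i then Z.succ (y j) else y j.

Definition left1 n (y : 'I_n -> Z) (i : 'I_n) : 'I_n -> Z :=
  fun j => if j == i then Z.pred (y j) else y j.

Lemma right1K n (y : 'I_n -> Z) i : left1 (right1 y i) i = y.
Proof.
by apply: functional_extensionality => j; rewrite /left1 /right1; case: eqP => // _; lia.
Qed.

Lemma left1_right1 n (y : 'I_n -> Z) i l : left1 (right1 y l) i = right1 (left1 y i) l.
Proof.
apply: functional_extensionality => j; rewrite /left1 /right1.
by case: eqP; case: eqP => // *; lia.
Qed.

Section FreeEvolution.
Variables (K : numDomainType) (n : nat).
Implicit Types (f : ('I_n -> Z) -> K) (y : 'I_n -> Z).

Definition free f y : K := \sum_(i < n) f (right1 y i).

Definition antisym (i j : 'I_n) f := forall y, f (y \o tperm i j) = - f y.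

(** Permuting the coordinates merely permutes the shifts, so [free] commutes with transpositions. *)
Lemma antisym_free i j f : antisym i j f -> antisym i j (free f).
Proof.
move=> fA y; rewrite /free -sumrN (reindex_inj (@perm_inj _ (tperm i j))).
apply: eq_bigr => l _; rewrite -fA; congr f.
apply: functional_extensionality => m; rewrite /right1 /=.
by rewrite (can2_eq (@tpermK _ i j) (@tpermK _ i j)).
Qed.

Lemma antisym_iter_free i j f t : antisym i j f -> antisym i j (iter t free f).
Proof. by move=> fA; elim: t => //= t; apply: antisym_free. Qed.

Lemma antisym_eq0 i j f y : antisym i j f -> y i = y j -> f y = 0.
Proof.
move=> fA yij; have : f y = - f y.
  rewrite -fA; congr f; apply: functional_extensionality => l /=.
  by case: tpermP => [->|->|].
by move/eqP; rewrite -subr_eq0 opprK -mulr2n mulrn_eq0 /= => /eqP.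
Qed.

Lemma free_sum (I : finType) (c : I -> K) (f : I -> ('I_n -> Z) -> K) :
  free (fun y => \sum_a c a * f a y) = fun y => \sum_a c a * free (f a) y.
Proof.
apply: functional_extensionality => y; rewrite /free exchange_big /=.
by apply: eq_bigr => a _; rewrite mulr_sumr.
Qed.

Lemma iter_free_sum (I : finType) (c : I -> K) (f : I -> ('I_n -> Z) -> K) t :
  iter t free (fun y => \sum_a c a * f a y) = fun y => \sum_a c a * iter t free (f a) y.
Proof. by elim: t => //= t ->; rewrite free_sum. Qed.

(** The exclusion rule [f (right1 y i) = f y] for [y (i+1) = y i + 1] is not stable
    under [free], but it follows from the antisymmetry of [diff i f] in the
    variables [i] and [i+1], which is. *)
Definition diff i f y := f y - f (left1 y i).

Lemma diff_iter_free i f t : diff i (iter t free f) = iter t free (diff i f).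
Proof.
elim: t => //= t <-; apply: functional_extensionality => y.
rewrite /free /diff -sumrB; apply: eq_bigr => l _.
by rewrite left1_right1.
Qed.

End FreeEvolution.

(** Pascal's rule: the additional shift falls either on [G] or on [F]. *)
Lemma binomial_conv_S (K : comNzRingType) (s : nat) (G F : nat -> K) :
  \sum_(j < s.+1) 'C(s, j)%:R * (G j.+1 * F (s - j)%N) +
  \sum_(j < s.+1) 'C(s, j)%:R * (G j * F (s - j).+1) =
  \sum_(j < s.+2) 'C(s.+1, j)%:R * (G j * F (s.+1 - j)%N).
Proof.
have -> : \sum_(j < s.+2) 'C(s.+1, j)%:R * (G j * F (s.+1 - j)%N) =
    G 0%N * F s.+1 + (\sum_(j < s.+1) 'C(s, j.+1)%:R * (G j.+1 * F (s - j)%N) +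
                      \sum_(j < s.+1) 'C(s, j)%:R * (G j.+1 * F (s - j)%N)).
  rewrite big_ord_recl bin0 mul1r subn0 -big_split /=; congr (_ + _).
  by apply: eq_bigr => j _; rewrite binS natrD mulrDl.
rewrite addrC addrA; congr (_ + _).
rewrite big_ord_recl bin0 mul1r subn0; congr (_ + _).
rewrite [RHS]big_ord_recr /= bin_small // mul0r addr0.
by apply: eq_bigr => j _; rewrite subnSK.
Qed.

(** The binomial formula for the commuting operators [shift of y_0] and [free] in
    the other variables. *)
Lemma iter_free_split (K : numDomainType) n (g : Z -> K) (f : ('I_n -> Z) -> K) s
    (y : 'I_n.+1 -> Z) :
  iter s (@free K n.+1) (fun y => g (y ord0) * f (y \o lift ord0)) y =
  \sum_(j < s.+1) 'C(s, j)%:R * (g (Z.add (y ord0) (Z.of_nat j)) *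
                                iter (s - j) (@free K n) f (y \o lift ord0)).
Proof.
elim: s y => [|s IH] y; first by rewrite big_ord1 /= bin0 mul1r Z.add_0_r.
rewrite /= {1}/free big_ord_recl !IH /=.
rewrite -[RHS](binomial_conv_S s (fun j => g (Z.add (y ord0) (Z.of_nat j)))
  (fun l => iter l (@free K n) f (y \o lift ord0))); congr (_ + _).
  apply: eq_bigr => j _; congr (_ * (_ * _)).
  by congr g; rewrite /right1 eqxx; lia.
under eq_bigr do rewrite IH.
rewrite exchange_big /=; apply: eq_bigr => j _.
rewrite -!mulr_sumr; congr (_ * _); rewrite /right1 /= -mulr_sumr; congr (_ * _).
Qed.

(** * Determinants of the [h_m]: boundary conditions and initial value *)

Section Determinants.
Variables (K : numDomainType) (h : nat -> Z -> K).
Hypothesis hS : forall m d, h m.+1 d = h m d + h m.+1 (Z.pred d).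
Hypothesis h_neg : forall m d, Z.lt d Z0 -> h m d = 0.
Hypothesis h_zero : forall m, h m Z0 = 1.
Hypothesis h0_pos : forall d, Z.lt Z0 d -> h 0 d = 0.

Definition hmat n (mu : 'I_n -> nat) (x : Z) (y : 'I_n -> Z) : 'M[K]_n :=
  \matrix_(i, j) h (mu i) (Z.sub (Z.sub (y i) x) (Z.of_nat j)).

Definition hdet n (mu : 'I_n -> nat) (x : Z) (y : 'I_n -> Z) : K := \det (hmat mu x y).

Lemma hdet_antisym n mu x (i j : 'I_n) :
  i != j -> mu i = mu j -> antisym i j (hdet mu x).
Proof.
move=> ij muij y; rewrite /hdet.
have -> : hmat mu x (y \o tperm i j) = row_perm (tperm i j) (hmat mu x y).
  apply/matrixP => a b; rewrite !mxE /=; congr h.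
  by case: tpermP => [->|->|].
by rewrite row_permE det_mulmx det_perm odd_tperm ij expr1 mulN1r.
Qed.

(** Only row [i] depends on [y i], so by multilinearity the difference is taken in that row, where
    [hS] lowers the exponent. *)
Lemma hdet_diff n mu x (i : 'I_n) m : mu i = m.+1 ->
  diff i (hdet mu x) = hdet (fun j => if j == i then m else mu j) x.
Proof.
move=> mui; apply: functional_extensionality => y; rewrite /diff.
apply/eqP; rewrite subr_eq; apply/eqP.
rewrite /hdet -[\det (hmat _ _ y) in RHS]mul1r -[\det (hmat _ _ (left1 _ _))]mul1r.
apply: (@determinant_multilinear _ _ _ _ _ i).
- apply/rowP => j; rewrite !mxE !mul1r eqxx mui hS /left1 eqxx.
  by congr (_ + h _ _); lia.
- apply/matrixP => a b; rewrite !mxE.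
  by rewrite eq_sym (negPf (neq_lift i a)).
- apply/matrixP => a b; rewrite !mxE /left1.
  by rewrite eq_sym (negPf (neq_lift i a)).
Qed.

(** Exponent of [1/(1 - xi_i)] in the integrand, with 0-indexed [i]. *)
Definition mexp (n k i : nat) : nat := (n - i - (i < k))%N.

(** Non-interacting evolution of a determinant that extends the indicator of the
    event from increasing to arbitrary [y]. *)
Definition freeU n k x t : ('I_n -> Z) -> K :=
  iter t (@free K n) (hdet (fun i : 'I_n => mexp n k i) x).

(** Here the exponent of row [i] exceeds that of row [j] by 1. After differencing in [i] the two
    agree, so the difference is antisymmetric, and it is evaluated at [right1 y i], whose
    coordinates [i] and [j] coincide. *)
Lemma freeU_blocked n k x t (i j : 'I_n) y : j = i.+1 :> nat -> i.+1 != k ->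
  y j = Z.succ (y i) -> freeU k x t (right1 y i) = freeU k x t y.
Proof.
move=> ji ik yji.
have ltj := ltn_ord j; have nij : i != j by rewrite -val_eqE /=; lia.
have mi : mexp n k i = (mexp n k j).+1.
  by rewrite /mexp ji; case: ltnP; case: ltnP => *; lia.
apply/eqP; rewrite -subr_eq0; apply/eqP.
rewrite -[y in X in _ - X](right1K y i) -/(diff i (freeU k x t) (right1 y i)).
rewrite /freeU diff_iter_free (hdet_diff _ mi).
apply: (@antisym_eq0 _ _ i j).
  apply: antisym_iter_free; apply: hdet_antisym => //.
  by rewrite eqxx eq_sym (negPf nij).
by rewrite /right1 eqxx eq_sym (negPf nij) yji.
Qed.

(** At the label boundary rows [i] and [j] have equal exponents from the start, so [freeU] itself is
    antisymmetric. *)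
Lemma freeU_exchange n k x t (i j : 'I_n) y : j = i.+1 :> nat -> i.+1 = k ->
  y j = Z.succ (y i) -> freeU k x t (right1 y i) = 0.
Proof.
move=> ji ik yji.
have ltj := ltn_ord j; have nij : i != j by rewrite -val_eqE /=; lia.
apply: (@antisym_eq0 _ _ i j).
  apply: antisym_iter_free; apply: hdet_antisym => //.
  by rewrite /mexp ji; case: ltnP; case: ltnP => *; lia.
by rewrite /right1 eqxx eq_sym (negPf nij) yji.
Qed.

Definition increasing n (y : 'I_n -> Z) :=
  forall i j : 'I_n, (i < j)%N -> Z.lt (y i) (y j).

Lemma increasing_ge n (y : 'I_n.+1 -> Z) (i : 'I_n.+1) : increasing y ->
  Z.le (Z.add (y ord0) (Z.of_nat i)) (y i).
Proof.
move=> yI; case: i => i; elim: i => [|i IH] lti /=.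
  by rewrite (_ : Ordinal lti = ord0); [lia|apply: val_inj].
have := IH (ltnW lti); have /= := yI (Ordinal (ltnW lti)) (Ordinal lti) (ltnSn i).
by lia.
Qed.

Lemma increasing_last n (y : 'I_n.+1 -> Z) (i : 'I_n.+1) : increasing y ->
  Z.le (Z.add (y i) (Z.of_nat (n - i))) (y ord_max).
Proof.
move=> yI; have [d] := ubnPeq (n - i)%N.
elim: d i => [|d IH] i.
  move=> hi; rewrite (_ : i = ord_max) /= ?subnn; first by lia.
  by apply: val_inj => /=; have := ltn_ord i; lia.
move=> hi; have lti : (i.+1 < n.+1)%N by lia.
have /= := IH (Ordinal lti); have /= := yI i (Ordinal lti) (ltnSn i).
by lia.
Qed.

Lemma det_row0_0 n (A : 'M[K]_n) i : (forall j, A i j = 0) -> \det A = 0.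
Proof.
move=> A0; rewrite (expand_det_row _ i) big1 // => j _; by rewrite A0 mul0r.
Qed.

Lemma h1_nonneg d : Z.le Z0 d -> h 1 d = 1.
Proof.
move=> d0; rewrite -(Z2Nat.id d) //; elim: (Z.to_nat d) => [|a IH]; first exact: h_zero.
rewrite hS h0_pos; last by lia.
by rewrite add0r (_ : Z.pred _ = Z.of_nat a) //; lia.
Qed.

(** Replacing each column but the last by its difference with the next one
    turns [h (m+1)] into [h m], and the last row, all ones, into [0 .. 0 1]. *)
Lemma hdet_reduce n (mu : 'I_n.+1 -> nat) x y :
  (forall i : 'I_n, (0 < mu (lift ord_max i))%N) -> mu ord_max = 1%N ->
  Z.le (Z.add x (Z.of_nat n)) (y ord_max) ->
  hdet mu x y = hdet (fun i : 'I_n => (mu (lift ord_max i)).-1) x (y \o lift ord_max).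
Proof.
move=> mu0 mu1 ylast.
pose D : 'M[K]_n.+1 := \matrix_(i, j) ((i == j)%:R - (val i == j.+1)%:R).
have detD : \det D = 1.
  rewrite det_trig; last first.
    apply/is_trig_mxP => i j ij; rewrite !mxE.
    by rewrite -val_eqE /= !ltn_eqF ?subr0 //; lia.
  rewrite big1 // => i _; rewrite !mxE eqxx (_ : (val i == _) = false) ?subr0 //.
  by apply/eqP => /=; lia.
have AD i j : (hmat mu x y *m D) i j = h (mu i) (Z.sub (Z.sub (y i) x) (Z.of_nat j)) -
    (if (j < n)%N then h (mu i) (Z.pred (Z.sub (Z.sub (y i) x) (Z.of_nat j))) else 0).
  rewrite mxE; under eq_bigr do rewrite !mxE mulrBr.
  rewrite sumrB (bigD1 j) //= eqxx mulr1 big1 ?addr0; last first.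
    by move=> l /negPf ->; rewrite mulr0.
  congr (_ - _); case: ifP => jn.
    rewrite (bigD1 (Ordinal (jn : (j.+1 < n.+1)%N))) //= eqxx mulr1 big1 ?addr0.
      by congr h; lia.
    by move=> l; rewrite -val_eqE /= => /negPf ->; rewrite mulr0.
  rewrite big1 // => l _; rewrite (_ : (_ == _) = false) ?mulr0 //.
  by apply/eqP; have := ltn_ord l; lia.
rewrite /hdet -[LHS]mulr1 -detD -det_mulmx (expand_det_row _ ord_max).
rewrite (bigD1 ord_max) //= big1 ?addr0; last first.
  move=> j; rewrite -val_eqE /= => jn; have := ltn_ord j => ltj.
  by rewrite AD ifT ?mu1 ?h1_nonneg ?subrr ?mul0r //; lia.
rewrite AD ltnn subr0 mu1 h1_nonneg ?mul1r; last by rewrite /=; lia.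
rewrite /cofactor addnn -signr_odd odd_double expr0 mul1r; congr (\det _).
apply/matrixP => i j; rewrite [LHS]mxE [LHS]mxE AD [RHS]mxE lift_max ltn_ord.
by rewrite -(prednK (mu0 i)) hS addrK.
Qed.

(** For [k = 0] the bound is put on every coordinate, which for increasing [y] amounts to the first.
    This form makes sense for [n = 0] and passes to the vector without its last entry. *)
Definition starts_at n (k : nat) (x : Z) (y : 'I_n -> Z) : bool :=
  [forall i : 'I_n, if k == 0 then Z.leb x (y i)
                    else (i < k)%N ==> Z.eqb (y i) (Z.add x (Z.of_nat i))].

(** Once [y_0 >= x], a second class particle at the right end does not affect the event, so
    induction removes it. When all particles are first class, the last row consists of values of
    [h 0], the indicator of 0, and decides directly. *)
Lemma hdet_initial n k x (y : 'I_n -> Z) : (k <= n)%N -> increasing y ->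
  hdet (fun i : 'I_n => mexp n k i) x y = (starts_at k x y)%:R.
Proof.
elim: n y => [|n IH] y kn yI.
  rewrite /hdet det_mx00 (_ : starts_at _ _ _ = true) //.
  by apply/forallP => -[].
(* If [y_0 < x], row 0 has only negative arguments and vanishes. *)
have [xy|yx] := Z.le_gt_cases x (y ord0); last first.
  rewrite /hdet (@det_row0_0 _ _ ord0); last first.
    by move=> j; rewrite mxE h_neg //; lia.
  rewrite (_ : starts_at _ _ _ = false) //; apply/negP => /forallP /(_ ord0) /=.
  case: eqP => [_ /Z.leb_le|k0]; first by lia.
  have -> /= : (0 < k)%N by lia.
  by move/Z.eqb_eq; lia.
have yge (i : 'I_n.+1) : Z.le (Z.add x (Z.of_nat i)) (y i).
  by have := increasing_ge (i := i) yI; lia.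
have [kN|kN] := eqVneq k n.+1; last first.
  (* The last particle is second class, of exponent 1; the lowered exponents of the others are those
     for [n] particles. *)
  rewrite hdet_reduce.
  - rewrite (_ : (fun _ => _) = (fun i : 'I_n => mexp n k i)); last first.
      apply: functional_extensionality => i; rewrite /mexp lift_max.
      by have := ltn_ord i; case: ltnP; lia.
    rewrite IH; last 2 first.
    + by lia.
    + by move=> i j ij; apply: yI; rewrite !lift_max.
    congr (_ %:R); congr nat_of_bool; apply/forallP/forallP => H i.
      have ylei := yge i.
      case: ifP (H) => [k0 _|k0 {}H]; first by apply/Z.leb_le; lia.
      apply/implyP => ik; have lin : (i < n)%N by lia.
      have := H (Ordinal lin); rewrite /= ik /=.
      by rewrite (_ : lift _ _ = i) //; apply: val_inj; exact: lift_max.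
    by have := H (lift ord_max i); rewrite lift_max.
  - by move=> i; rewrite /mexp lift_max; have := ltn_ord i; case: ltnP; lia.
  - by rewrite /mexp /=; case: ltnP; lia.
  - exact: (yge ord_max).
(* Now [k = n + 1]. As [y_i >= x + i], a last position at most [x + n] forces [y_i = x + i] for all
   [i], and the matrix is lower unitriangular. Otherwise the last row has only positive arguments,
   where [h 0] vanishes. *)
have [ylast|ylast] := Z.le_gt_cases (y ord_max) (Z.add x (Z.of_nat n)).
  have yeq (i : 'I_n.+1) : y i = Z.add x (Z.of_nat i).
    have := yge i; have := increasing_last (i := i) yI; have := ltn_ord i; lia.
  rewrite /hdet det_trig; last first.
    apply/is_trig_mxP => i j ij; rewrite mxE h_neg //; rewrite yeq; lia.
  rewrite big1; last first.
    by move=> i _; rewrite mxE yeq (_ : Z.sub _ _ = Z0) ?h_zero //; lia.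
  rewrite (_ : starts_at _ _ _ = true) //; apply/forallP => i; rewrite kN /=.
  by apply/implyP => _; apply/Z.eqb_eq.
rewrite /hdet (@det_row0_0 _ _ ord_max); last first.
  move=> j; rewrite mxE (_ : mexp _ _ _ = 0%N); last by rewrite /mexp kN /=; lia.
  by rewrite h0_pos //; have := ltn_ord j; lia.
rewrite (_ : starts_at _ _ _ = false) //; apply/negP => /forallP /(_ ord_max).
by rewrite kN /= ltnSn /= => /Z.eqb_eq; lia.
Qed.

End Determinants.

End Determinants.

Module Contour.
Import HB.structures FunctionalExtensionality Coquelicot.Coquelicot.
Import all_boot all_order all_fingroup all_algebra Rstruct zify.
Import Pilot.Defs Analysis Determinants.
Set Implicit Arguments. Unset Strict Implicit. Unset Printing Implicit Defensive.
Import GRing.Theory Num.Theory.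
Delimit Scope R_scope with coqR.
Local Open Scope ring_scope.

(** * Path counts and contour integrals as determinants *)

Lemma fold_right_big (T : Type) (idx : T) (op : T -> T -> T) (f : nat -> T) n :
  fold_right (fun i acc => op (f i) acc) idx (List.seq 0 n) = \big[op/idx]_(i < n) f i.
Proof.
have -> : List.seq 0 n = iota 0 n by elim: n 0%N => //= n IH a; rewrite IH.
by rewrite -(big_mkord xpredT) bigop.unlock /index_iota subn0.
Qed.

(** * Complex numbers as a commutative ring, and limits of determinants *)

Definition pair_of_C (z : C) : R * R := (Defs.Re z, Defs.Im z).
Definition C_of_pair (p : R * R) : C := mkC p.1 p.2.
Lemma pair_of_CK : cancel pair_of_C C_of_pair. Proof. by case. Qed.
HB.instance Definition _ := Choice.copy C (can_type pair_of_CK).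

Fact Cadd_assoc : associative Cadd. Proof. by move=> *; apply: C_ext; apply: addrA. Qed.
Fact Cadd_comm : commutative Cadd. Proof. by move=> *; apply: C_ext; apply: addrC. Qed.
Fact Cadd_0l : left_id C0 Cadd. Proof. by move=> *; apply: C_ext; apply: add0r. Qed.
Fact Cadd_oppl : left_inverse C0 Copp Cadd.
Proof. by move=> *; apply: C_ext; apply: addNr. Qed.
HB.instance Definition _ := GRing.isZmodule.Build C Cadd_assoc Cadd_comm Cadd_0l Cadd_oppl.

Fact Cmul_assoc : associative Cmul. Proof. move=> x y z; exact: (Rmul_assoc C_ring_theory). Qed.
Fact Cmul_comm : commutative Cmul. Proof. move=> x y; exact: (Rmul_comm C_ring_theory). Qed.
Fact Cmul_1l : left_id C1 Cmul. Proof. move=> x; exact: (Rmul_1_l C_ring_theory). Qed.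
Fact Cmul_addl : left_distributive Cmul Cadd.
Proof. move=> x y z; exact: (Rdistr_l C_ring_theory). Qed.
Fact C1_neq0 : C1 != C0.
Proof. by apply/eqP => /(f_equal Defs.Re) /= /R1_neq_R0. Qed.
HB.instance Definition _ :=
  GRing.Zmodule_isComNzRing.Build C Cmul_assoc Cmul_comm Cmul_1l Cmul_addl C1_neq0.

Fact RtoC_additive : zmod_morphism RtoC.
Proof. by move=> x y; apply: C_ext => //=; rewrite Rplus_0_l Ropp_0. Qed.
Fact RtoC_multiplicative : monoid_morphism RtoC.
Proof. split=> // x y; apply: C_ext; rewrite /= ?Rmult_0_l ?Rmult_0_r ?Rminus_0_r ?Rplus_0_l //. Qed.
HB.instance Definition _ := GRing.isZmodMorphism.Build R C RtoC RtoC_additive.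
HB.instance Definition _ := GRing.isMonoidMorphism.Build R C RtoC RtoC_multiplicative.

Lemma CpowE z n : Cpow z n = z ^+ n.
Proof. by elim: n => //= n ->; rewrite exprS. Qed.

Lemma clim_big (op : C -> C -> C) (idx : C) (I : Type) (s : seq I) (u : I -> nat -> C) (l : I -> C) :
  (forall v w a b, clim v a -> clim w b -> clim (fun n => op (v n) (w n)) (op a b)) ->
  (forall i, clim (u i) (l i)) ->
  clim (fun n => \big[op/idx]_(i <- s) u i n) (\big[op/idx]_(i <- s) l i).
Proof.
move=> opP ul; elim: s => [|i s IH].
  by rewrite big_nil; apply: (clim_ext _ _ _ _ (clim_const _)) => n; rewrite big_nil.
rewrite big_cons; apply: (clim_ext _ _ _ _ (opP _ _ _ _ (ul i) IH)) => n.
by rewrite big_cons.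
Qed.

Lemma clim_det n (A : nat -> 'M[C]_n) (B : 'M[C]_n) :
  (forall i j, clim (fun M => A M i j) (B i j)) -> clim (fun M => \det (A M)) (\det B).
Proof.
move=> AB; apply: clim_big => [|s]; first exact: clim_add.
apply: (clim_mul _ _ _ _ (clim_const _)).
by apply: clim_big => //; apply: clim_mul.
Qed.

(** * Path counts as free evolution *)

Lemma hcoefS m d : hcoef m.+1 d = hcoef m d + hcoef m.+1 (Z.pred d).
Proof. exact: hcoef_S. Qed.

Definition positions N (Y : list Z) : 'I_N -> Z := fun i => List.nth i Y Z0.
Arguments positions : clear implicits.

Lemma positions_bump N (Y : list Z) (i : 'I_N) : length Y = N ->
  positions N (bump_at i Y) = right1 (positions N Y) i.
Proof.
move=> YN; apply: functional_extensionality => j.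
rewrite /positions nth_bump_at; last by rewrite YN; apply/ltP.
rewrite /right1 -val_eqE /=.
by case: PeanoNat.Nat.eqb_spec => [->|/eqP/negPf ->] //; rewrite eqxx.
Qed.

Definition steps_up N (Y : list Z) :=
  forall i, (i.+1 < N)%N -> Z.lt (List.nth i Y Z0) (List.nth i.+1 Y Z0).

Lemma steps_up_increasing N Y : steps_up N Y -> increasing (positions N Y).
Proof.
move=> H [i lti] [j ltj] /=; rewrite /positions /=.
elim: j ltj => // j IH ltj; rewrite ltnS leq_eqVlt => /orP[/eqP ->|ij].
  exact: H.
by have := IH (ltnW ltj) ij; have := H j ltj; lia.
Qed.

Lemma event_E_starts_at N k x Y : (k <= N)%N -> length Y = N -> (0 < N)%N ->
  increasing (positions N Y) ->
  event_E N k x (combine Y (nu N k)) = starts_at k x (positions N Y).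
Proof.
move=> kN YN N0 YI; rewrite event_E_init //; last exact/leP.
rewrite /starts_at; case: k kN => [|k] kN /=.
  case: N N0 YN YI {kN} => // N _ YN YI; apply/idP/forallP => [/Z.leb_le H i|/(_ ord0)] //.
  apply/Z.leb_le; have := increasing_ge (i := i) YI; rewrite {1}/positions /=; lia.
rewrite -[_ && _]/(forallb _ (List.seq 0 k.+1)); apply/idP/forallP.
  move=> /forallb_forall H i; apply/implyP => ik; apply: H.
  by apply/in_seq; split; [lia|apply/ltP].
move=> H; apply/forallb_forall => j /in_seq [_ /ltP jk].
by have := H (Ordinal (leq_trans jk kN)); rewrite /= jk.
Qed.

(** The attempt of particle [i] is matched with the shift of [y_i] in [free]. A shift that leaves
    the increasing vectors is evaluated by [freeU_blocked] or [freeU_exchange]. *)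
Lemma count_paths_free N k x t Y : (k <= N)%N -> length Y = N -> (0 < N)%N ->
  steps_up N Y ->
  count_paths N (event_E N k x) t (combine Y (nu N k)) = freeU hcoef k x t (positions N Y).
Proof.
move=> kN YN N0; elim: t Y YN => [|t IH] Y YN Yup.
  have YI := steps_up_increasing Yup.
  rewrite /freeU /= (hdet_initial hcoefS) //; first last.
  - exact: hcoef_pos0.
  - exact: hcoef_0.
  - exact: hcoef_neg.
  by rewrite event_E_starts_at //; case: ifP.
have lnu : length (nu N k) = N by apply: length_nu; apply/leP.
rewrite /= fold_right_big /freeU /= /free; apply: eq_bigr => i _.
rewrite -/(freeU hcoef k x t (right1 (positions N Y) i)).
have iN := ltn_ord i.
have [/andP[iN' /Z.eqb_eq adj]|free_i] := boolP ((i.+1 < N)%N &&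
    Z.eqb (List.nth i.+1 Y Z0) (Z.succ (List.nth i Y Z0))); last first.
  have ne : (i.+1 < N)%N -> List.nth i.+1 Y Z0 <> Z.succ (List.nth i Y Z0).
    by move=> lti e; move: free_i; rewrite lti e Z.eqb_refl.
  rewrite jump_free ?YN ?lnu //; last 2 first.
  - exact/ltP.
  - by move=> /ltP.
  rewrite IH ?length_bump_at //; first by rewrite positions_bump.
  move=> j jN; rewrite !nth_bump_at ?YN; try exact/ltP.
  have := Yup j jN.
  case: PeanoNat.Nat.eqb_spec => [e|_]; case: PeanoNat.Nat.eqb_spec => [|_]; try lia.
  (* Here [j = i] is the particle that moved; its target was empty, so its gap to the right was at
     least 2. *)
  by move: jN; rewrite e => /ne; lia.
(* Consecutive labels of [nu N k] differ only at [i + 1 = k]; elsewhere a jump onto the neighbour is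
   suppressed. *)
have [ik|ik] := eqVneq i.+1 k.
  rewrite (freeU_exchange hcoef _ _ (j := Ordinal iN')) // count_paths_dead // -ik.
  apply: firsts_exchange => //; rewrite ?YN ?ik ?lnu //.
  - by lia.
  - by apply: nth_nu_first; lia.
  - by apply: nth_nu_second; lia.
rewrite jump_blocked ?YN ?lnu //; last 2 first.
- exact/ltP.
- have [lt_ik|le_ki] := ltnP i k.
    by rewrite !nth_nu_first //; lia.
  by rewrite !nth_nu_second //; lia.
by rewrite IH // (freeU_blocked hcoefS _ _ (j := Ordinal iN')).
Qed.

(** * Exponential series of the free evolution *)

Lemma sum_f_R0_big (f : nat -> R) n : sum_f_R0 f n = \sum_(i < n.+1) f i.
Proof. by elim: n => [|n IH]; rewrite ?big_ord1 // big_ord_recr /= -IH. Qed.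

Lemma Binomial_C_nat n m : (m <= n)%N -> Binomial.C n m = 'C(n, m)%:R :> R.
Proof.
move=> mn; have factE' k : Factorial.fact k = k`! by elim: k => // k IH; rewrite factS -IH.
rewrite /Binomial.C minusE !factE' -!INRE -(bin_fact mn) !mult_INR.
have f0 k : INR k`! <> 0%R by apply/not_0_INR/eqP; rewrite -lt0n fact_gt0.
by field; split; apply: f0.
Qed.

(** The exponential of a sum of commuting shifts is the product of their exponentials; coordinates
    are split off one by one with [iter_free_split]. *)
Lemma is_series_prod_egf n (g : 'I_n -> Z -> R) (y : 'I_n -> Z) t : (0 <= t) ->
  (forall i d, 0 <= g i d) ->
  (forall i, ex_series (egf t (fun s => g i (Z.add (y i) (Z.of_nat s))))) ->
  is_series (egf t (fun s => iter s (@free R n) (fun y => \prod_i g i (y i)) y))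
    (\prod_i Series (egf t (fun s => g i (Z.add (y i) (Z.of_nat s))))).
Proof.
move=> /RleP t0; elim: n g y => [|n IH] g y g0 gex.
  rewrite big_ord0.
  (* Without coordinates [free] is the zero operator, so only the term of index 0 survives. *)
  apply: (@is_series_ext R_AbsRing R_NormedModule
    (fun s => match s with O => R1 | S _ => R0 end)).
    case=> [|s] /=; first by rewrite /egf /= big_ord0 Rdiv_1_r Rmult_1_r.
    by rewrite /egf iterS {1}/free big_ord0 Rmult_0_r.
  exact: is_series_single.
have free0 s (f : ('I_n -> Z) -> R) z : (forall y, 0 <= f y) -> (0 <= iter s (@free R n) f z).
  move=> f0; elim: s z => //= s IHs z; rewrite /free.
  exact: sumr_ge0.
rewrite big_ord_recl.
have IH' := IH (fun i => g (lift ord0 i)) (y \o lift ord0) (fun i => g0 _) (fun i => gex _).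
have := is_series_egf_mul t _ _ _ _ t0 _ _ (Series_correct _ (gex ord0)) IH'.
move=> H; apply: (@is_series_ext R_AbsRing R_NormedModule _ _ _ _ (H _ _)) => [s||].
- rewrite /egf; congr (_ * _).
  transitivity (iter s (@free R n.+1) (fun z => g ord0 (z ord0) *
      \prod_(i < n) g (lift ord0 i) ((z \o lift ord0) i)) y); last first.
    by congr (iter _ _ _ _); apply: functional_extensionality => z; rewrite big_ord_recl.
  rewrite sum_f_R0_big (iter_free_split (g ord0)
    (fun z => \prod_(i < n) g (lift ord0 i) (z i))).
  by apply: eq_bigr => j _; rewrite Binomial_C_nat // -ltnS.
- by move=> s; apply/RleP/g0.
- by move=> s; apply/RleP/free0 => z; apply: prodr_ge0.
Qed.

Lemma is_series_lincomb (I : Type) (s : seq I) (c : I -> R) (u : I -> nat -> R) (l : I -> R) :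
  (forall a, is_series (u a) (l a)) ->
  is_series (fun n => \sum_(a <- s) c a * u a n) (\sum_(a <- s) c a * l a).
Proof.
move=> ul; elim: s => [|a s IH].
  rewrite big_nil; apply: (@is_series_ext R_AbsRing R_NormedModule
    (fun n => (IZR Z0 * (match n with O => R1 | S _ => R0 end))%R)).
    by move=> n; rewrite big_nil; apply: mul0r.
  rewrite (_ : 0 = scal (IZR Z0) R1 :> R); last by apply/esym; apply: mul0r.
  exact: (@is_series_scal_l R_AbsRing R_NormedModule (IZR Z0) _ _ is_series_single).
rewrite big_cons; apply: (@is_series_ext R_AbsRing R_NormedModule
  (fun n => (c a * u a n + \sum_(b <- s) c b * u b n)%R)).
  by move=> n; rewrite big_cons.
apply: (@is_series_plus R_AbsRing R_NormedModule _ _ _ _ _ IH).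
exact: (@is_series_scal_l R_AbsRing R_NormedModule (c a) _ _ (ul a)).
Qed.

Definition hegf_mx N k x (t : R) (y : 'I_N -> Z) : 'M[R]_N :=
  \matrix_(i, j) hegf (mexp N k i) (Z.sub (Z.sub (y i) x) (Z.of_nat j)) t.

(** The Leibniz expansion comes first, because factorization and nonnegativity hold for its single
    products and not for the determinant. *)
Lemma is_series_freeU N k x (t : R) (y : 'I_N -> Z) : 0 <= t ->
  is_series (egf t (fun s => freeU hcoef k x s y)) (\det (hegf_mx k x t y)).
Proof.
move=> t0; rewrite /freeU /hdet /determinant.
apply: (@is_series_ext R_AbsRing R_NormedModule (fun n => \sum_(s : 'S_N) (-1) ^+ s *
  egf t (fun u => iter u (@free R N) (fun y => \prod_(i < N) hcoef (mexp N k i)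
    (Z.sub (Z.sub (y i) x) (Z.of_nat (s i)))) y) n)).
  move=> n; rewrite /egf.
  have -> : (fun z : 'I_N -> Z => \sum_(s : 'S_N) (-1) ^+ s * \prod_(i < N)
     hmat hcoef (fun i : 'I_N => mexp N k i) x z i (s i)) =
     (fun z => \sum_(s : 'S_N) (-1) ^+ s * (fun z => \prod_(i < N) hcoef (mexp N k i)
    (Z.sub (Z.sub (z i) x) (Z.of_nat (s i)))) z).
    apply: functional_extensionality => z; apply: eq_bigr => s _.
    by congr (_ * _); apply: eq_bigr => i _; rewrite mxE.
  rewrite iter_free_sum [RHS]RmultE mulr_sumr; apply: eq_bigr => s _.
  by rewrite RmultE mulrCA.
apply: is_series_lincomb => s.
have -> : \prod_(i < N) hegf_mx k x t y i (s i) = \prod_(i < N) Series (egf t (fun u =>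
    (fun (i : 'I_N) d => hcoef (mexp N k i) (Z.sub (Z.sub d x) (Z.of_nat (s i)))) i
      (Z.add (y i) (Z.of_nat u)))).
  apply: eq_bigr => i _; rewrite mxE; apply: Series_ext => u; rewrite /egf.
  by congr (_ * hcoef _ _); lia.
apply: (is_series_prod_egf (g := fun (i : 'I_N) d => hcoef (mexp N k i)
  (Z.sub (Z.sub d x) (Z.of_nat (s i))))) => // [i d|i].
  exact/RleP/hcoef_ge0.
have [l Hl] := ex_hegf (mexp N k i) (Z.sub (Z.sub (y i) x) (Z.of_nat (s i))) t (RleP t0).
exists l; apply: (@is_series_ext R_AbsRing R_NormedModule _ _ _ _ Hl) => u.
by rewrite /egf; congr (_ * hcoef _ _); lia.
Qed.

Lemma is_prob_det N k x (t : R) Y : (k <= N)%N -> length Y = N -> (0 < N)%N -> steps_up N Y ->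
  0 <= t ->
  is_prob N (combine Y (nu N k)) t (event_E N k x)
    (exp (- INR N * t) * \det (hegf_mx k x t (positions N Y)))%R.
Proof.
move=> kN YN N0 Yup t0; apply/is_series_Reals.
have H := @is_series_freeU N k x t (positions N Y) t0.
apply: (@is_series_ext R_AbsRing R_NormedModule _ _ _ _
  (@is_series_scal_l R_AbsRing R_NormedModule (exp (- INR N * t)) _ _ H)) => n.
rewrite /prob_series /egf count_paths_free // /scal /= /mult /=.
by rewrite /Rdiv !Rmult_assoc.
Qed.

(** * Riemann sums as determinants *)

Lemma CsumE (A : Type) (s : seq A) (f : A -> C) : Csum s f = \sum_(a <- s) f a.
Proof. by elim: s => [|a s IH]; rewrite ?big_nil // big_cons -IH. Qed.

Lemma csumE (f : nat -> C) n : csum f n = \sum_(i < n) f i.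
Proof. by elim: n => [|n IH]; rewrite ?big_ord0 // big_ord_recr /= -IH. Qed.

Lemma gridS n M : grid n.+1 M = [seq m :: ms | m <- iota 0 M, ms <- grid n M].
Proof.
rewrite /=; have -> : List.seq 0 M = iota 0 M by elim: M 0%N => //= M IH a; rewrite IH.
by elim: (iota 0 M) => //= m s ->.
Qed.

Lemma size_grid n M ms : ms \in grid n M -> size ms = n.
Proof.
elim: n ms => [|n IH] ms; first by rewrite inE => /eqP ->.
by rewrite gridS => /allpairsP[[m ms'] /= [_ /IH <- ->]].
Qed.

Lemma sum_grid_prod n M (g : 'I_n -> nat -> C) :
  \sum_(ms <- grid n M) \prod_(i < n) g i (List.nth i ms 0%N) =
  \prod_(i < n) \sum_(l < M) g i l.
Proof.
elim: n g => [|n IH] g; first by rewrite big_seq1 !big_ord0.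
rewrite gridS big_allpairs_dep big_ord_recl.
rewrite -(big_mkord xpredT (g ord0)) /index_iota subn0 mulr_suml.
apply: eq_bigr => m _; rewrite -(IH (fun i => g (lift ord0 i))) mulr_sumr.
apply: eq_bigr => ms _.
by rewrite big_ord_recl.
Qed.

(** Row [i] depends on the [i]-th grid variable alone, so each Leibniz product sums factor by
    factor. *)
Lemma sum_grid_det n M (T : 'I_n -> 'I_n -> nat -> C) :
  \sum_(ms <- grid n M) \det (\matrix_(i, j) T i j (List.nth i ms 0%N)) =
  \det (\matrix_(i, j) \sum_(l < M) T i j l).
Proof.
rewrite exchange_big /=; apply: eq_bigr => s _.
rewrite -mulr_sumr; congr (_ * _).
transitivity (\prod_(i < n) \sum_(l < M) T i (s i) l).
  rewrite -(sum_grid_prod M (fun i => T i (s i))).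
  by apply: eq_bigr => ms _; apply: eq_bigr => i _; rewrite mxE.
by apply: eq_bigr => i _; rewrite mxE.
Qed.

Lemma det_scale_rows (K : comNzRingType) n (a : 'I_n -> K) (A : 'I_n -> 'I_n -> K) :
  \det (\matrix_(i, j) (a i * A i j)) = (\prod_i a i) * \det (\matrix_(i, j) A i j).
Proof.
have -> : \matrix_(i, j) (a i * A i j) = diag_mx (\row_i a i) *m \matrix_(i, j) A i j.
  by apply/matrixP => i j; rewrite mul_diag_mx !mxE.
by rewrite det_mulmx det_diag; congr (_ * _); apply: eq_bigr => i _; rewrite mxE.
Qed.

Lemma det_powers (K : comNzRingType) n (z : 'I_n -> K) :
  \det (\matrix_(i, j) z i ^+ j) = \prod_(i < n) \prod_(j < n | (i < j)%N) (z j - z i).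
Proof.
rewrite -det_tr; transitivity (\det (Vandermonde n (\row_i z i))).
  by congr (\det _); apply/matrixP => i j; rewrite !mxE.
rewrite det_Vandermonde; apply: eq_bigr => i _; apply: eq_bigr => j _.
by rewrite !mxE.
Qed.

Lemma prod_lower_triangle (K : comNzRingType) n (F : nat -> nat -> K) :
  \prod_(j < n) \prod_(i < j) F j i = \prod_(i < n) \prod_(j < n | (i < j)%N) F j i.
Proof.
rewrite (exchange_big_dep xpredT) //=; apply: eq_bigr => j _.
exact: (big_ord_widen n (F j) (ltnW (ltn_ord j))).
Qed.

Definition entry (m : nat) (p : Z) (t : R) (j : nat) (z : C) : C :=
  Cmul (Cpow z j) (Cmul (Cpow (Cinv (Csub C1 z)) m)
    (Cmul (CpowZ z p) (Cexp (Cmul (veps z) (RtoC t))))).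

(** With [w = 1/(1 - xi_i)], the pairs [i < j] give [N - i - 1] factors, the single product gives
    one more, and for [i < k] the factor [1 - xi_i] cancels one. *)
Lemma mexp_split (K : comNzRingType) (u w : K) N k i : (i < N)%N -> u * w = 1 ->
  (if (i < k)%N then u else 1) * (w ^+ (N - i.+1) * w) = w ^+ mexp N k i.
Proof.
move=> iN uw; rewrite /mexp -exprSr subnSK //; case: ifP => ik; last by rewrite mul1r subn0.
by rewrite -subnSK // exprS mulrA uw mul1r subn1.
Qed.

Lemma integrand_det N k x Y (t : R) xi : (k <= N)%N ->
  (forall i, (i < N)%N -> Csub C1 (List.nth i xi C0) <> C0) ->
  integrand N k x Y t xi = \det (\matrix_(i < N, j < N)
    entry (mexp N k i) (Z.sub (Z.sub x (List.nth i Y Z0)) (Zpos xH)) t j (List.nth i xi C0)).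
Proof.
move=> kN nz; pose z i := List.nth i xi C0; pose w i := Cinv (Csub C1 (z i)).
pose e i := Cmul (CpowZ (z i) (Z.sub (Z.sub x (List.nth i Y Z0)) (Zpos xH)))
  (Cexp (Cmul (veps (z i)) (RtoC t))).
transitivity (\det (\matrix_(i < N, j < N) ((w i ^+ mexp N k i * e i) * z i ^+ j))); last first.
  congr (\det _); apply/matrixP => i j; rewrite !mxE /entry !CpowE.
  by rewrite -[RHS]/(z i ^+ j * (w i ^+ mexp N k i * e i)) mulrC.
rewrite det_scale_rows det_powers.
have -> : integrand N k x Y t xi = (\prod_(i < k) (1 - z i)) *
   ((\prod_(j < N) \prod_(i < j) ((z j - z i) * w i)) *
    ((\prod_(i < N) w i) * \prod_(i < N) e i)).
  rewrite /integrand /Cprod !fold_right_big; congr (_ * (_ * _)).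
  by apply: eq_bigr => j _; rewrite fold_right_big.
rewrite (prod_lower_triangle N (fun j i => (z j - z i) * w i)).
set V := \prod_(i < N) \prod_(j < N | _) (z j - z i).
have -> : \prod_(i < N) \prod_(j < N | (i < j)%N) ((z j - z i) * w i) =
    V * \prod_(i < N) w i ^+ (N - i.+1).
  rewrite -big_split /=; apply: eq_bigr => i _; rewrite big_split /=; congr (_ * _).
  by rewrite -prodr_const_nat big_geq_mkord; apply: eq_bigl => j.
rewrite (big_ord_widen N (fun i => 1 - z i) kN) big_mkcond /=.
have -> : \prod_(i < N) (w i ^+ mexp N k i * e i) = \prod_(i < N)
    (((if (i < k)%N then 1 - z i else 1) * (w i ^+ (N - i.+1) * w i)) * e i).
  apply: eq_bigr => i _; rewrite mexp_split //.
  exact: (Cmul_inv _ (nz i (ltn_ord i))).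
rewrite !big_split /= -!mulrA; congr (_ * _).
by rewrite mulrCA; congr (_ * _); rewrite mulrA mulrC !mulrA.
Qed.

Lemma fold_right_prod (xi : seq C) :
  fold_right (fun z acc => Cmul (Cmul Ci z) acc) C1 xi =
  \prod_(i < size xi) (Ci * List.nth i xi C0).
Proof.
by elim: xi => [|z xi IH]; rewrite ?big_ord0 // big_ord_recl /= -IH.
Qed.

(** An identity for each [M], which reduces the [N]-fold limit to entrywise one-variable limits. *)
Lemma circle_riemann_sum_det N k x Y (t r : R) M : (k <= N)%N -> (0 < r < 1)%coqR ->
  circle_riemann_sum N r (integrand N k x Y t) M =
  \det (\matrix_(i < N, j < N) csum (fun l =>
     let z := circ r (2 * PI / INR M * INR l)%coqR in
     Cmul (Cmul (RtoC (2 * PI / INR M)%coqR) (Cmul Ci z))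
       (entry (mexp N k i) (Z.sub (Z.sub x (List.nth i Y Z0)) (Zpos xH)) t j z)) M).
Proof.
move=> kN r01; rewrite /circle_riemann_sum CsumE.
set hh := (2 * PI / INR M)%coqR.
pose zl l := circ r (hh * INR l)%coqR.
pose T (i j : 'I_N) l := (RtoC hh * (Ci * zl l)) *
   entry (mexp N k i) (Z.sub (Z.sub x (List.nth i Y Z0)) (Zpos xH)) t j (zl l).
transitivity (\sum_(ms <- grid N M) \det (\matrix_(i, j) T i j (List.nth i ms 0%N))); last first.
  by rewrite sum_grid_det; congr (\det _); apply/matrixP => i j; rewrite !mxE csumE.
apply: eq_big_seq => ms /size_grid msN.
have nth_xi i : (i < N)%N ->
    List.nth i [seq zl m | m <- ms] C0 = zl (List.nth i ms 0%N).
  (* [map_nth] yields the default [zl 0] instead of [C0]; the index is in range, so the two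
     agree. *)
  move=> iN; rewrite -(List.map_nth zl); apply: nth_indep.
  by rewrite length_map; apply/ltP; move: iN; rewrite -msN.
rewrite -[List.map _ ms]/[seq zl m | m <- ms] integrand_det //; last first.
  by move=> i iN; rewrite nth_xi //; apply: C1_sub_circ_neq0.
rewrite (det_scale_rows (fun i : 'I_N => RtoC hh * (Ci * zl (List.nth i ms 0%N)))
  (fun i j : 'I_N => entry (mexp N k i) (Z.sub (Z.sub x (List.nth i Y Z0)) (Zpos xH)) t j
      (zl (List.nth i ms 0%N)))).
rewrite fold_right_prod size_map msN.
have -> : RtoC (hh ^ N)%coqR = \prod_(i < N) RtoC hh.
  by rewrite prodr_const card_ord RpowE rmorphXn.
set P := \prod_(i < N) RtoC hh; set Q := \prod_(i < N) (Ci * _).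
set D := \det (\matrix_(i, j) entry _ _ t _ (List.nth _ [seq zl m | m <- ms] C0)).
rewrite -[LHS]/(P * (D * Q)) mulrCA [RHS]mulrC; congr (_ * _).
  by congr (\det _); apply/matrixP => i j; rewrite !mxE nth_xi.
by rewrite -big_split; apply: eq_bigr => i _; rewrite nth_xi.
Qed.

Lemma exp_mul_nat (t : R) N : exp (- INR N * t)%coqR = exp (- t)%coqR ^+ N.
Proof.
elim: N => [|N IH]; first by rewrite Ropp_0 Rmult_0_l exp_0.
by rewrite exprS -IH -RmultE -exp_plus S_INR; congr exp; rewrite /=; ring.
Qed.

Lemma clim_contour N k x Y (t r : R) : (k <= N)%N -> (0 < r < 1)%coqR -> (0 <= t)%coqR ->
  clim (circle_riemann_sum N r (integrand N k x Y t))
    (Cmul (Cpow (Cmul (RtoC (2 * PI)%coqR) Ci) N)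
       (RtoC (exp (- INR N * t)%coqR * \det (hegf_mx k x t (positions N Y))))).
Proof.
move=> kN r01 t0.
have -> : Cmul (Cpow (Cmul (RtoC (2 * PI)%coqR) Ci) N)
    (RtoC (exp (- INR N * t)%coqR * \det (hegf_mx k x t (positions N Y)))) =
    \det (\matrix_(i < N, j < N) (Cmul (Cmul (RtoC (2 * PI)%coqR) Ci)
      (RtoC (exp (- t)%coqR * hegf (mexp N k i)
         (Z.opp (Z.add (Z.add (Z.sub (Z.sub x (List.nth i Y Z0)) (Zpos xH)) (Z.of_nat j)) (Zpos xH))) t)))).
  rewrite -[RHS]/(\det (\matrix_(i < N, j < N) _)).
  set c := Cmul _ Ci; rewrite CpowE.
  have -> : \matrix_(i < N, j < N) (Cmul c (RtoC (exp (- t)%coqR * hegf (mexp N k i)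
      (Z.opp (Z.add (Z.add (Z.sub (Z.sub x (List.nth i Y Z0)) (Zpos xH)) (Z.of_nat j)) (Zpos xH))) t)))
      = c *: map_mx RtoC (exp (- t)%coqR *: hegf_mx k x t (positions N Y)).
    apply/matrixP => i j; rewrite !mxE; congr (_ * RtoC (_ * hegf _ _ _)).
    (* The 1 gained from [d xi] cancels the [-1] in the exponent [x - y_i - 1], leaving the index
       [y_i - x - j]. *)
    by rewrite /positions; lia.
  by rewrite detZ det_map_mx detZ exp_mul_nat.
apply: (clim_ext (fun M => _)) => [M|]; first by rewrite (circle_riemann_sum_det _ _ _ _ kN r01).
apply: clim_det => i j; rewrite mxE.
apply: (clim_ext _ _ _ _ (contour_riemann (mexp N k i) (Z.sub (Z.sub x (List.nth i Y Z0)) (Zpos xH)) j t r r01 t0)) => M.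
by rewrite mxE.
Qed.

Lemma contour_formula (N : nat) (Y : list Z) (x : Z) (t r : R) (k : nat) :
  Peano.le 1 N -> length Y = N -> Sorted.Sorted Z.lt Y ->
  (0 <= t)%coqR -> (0 < r < 1)%coqR -> Peano.le k N ->
  exists p : R,
    is_prob N (init_state N k Y) t (event_E N k x) p /\
    is_circle_integral N r (integrand N k x Y t)
      (Cmul (Cpow (Cmul (RtoC (2 * PI)%coqR) Ci) N) (RtoC p)).
Proof.
move=> /leP N0 YN Ysorted t0 r01 /leP kN.
exists (exp (- INR N * t)%coqR * \det (hegf_mx k x t (positions N Y))); split.
  apply: is_prob_det => //; last exact/RleP.
  by move=> i iN; apply: Sorted_nth => //; rewrite YN; apply/ltP.
have [HR HI] := clim_contour x Y kN r01 t0.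
move=> eps eps0.
have [N1 H1] := proj2 (is_lim_seq_spec _ _) HR (mkposreal eps eps0).
have [N2 H2] := proj2 (is_lim_seq_spec _ _) HI (mkposreal eps eps0).
exists (maxn N1 N2) => M /leP HM; split.
  by apply: H1; apply/leP; apply: leq_trans HM; apply: leq_maxl.
by apply: H2; apply/leP; apply: leq_trans HM; apply: leq_maxr.
Qed.

End Contour.

Theorem theorem1p1 (N : nat) (Y : list Z) (x : Z) (t r : R) (k : nat) :
  (1 <= N)%nat ->
  length Y = N -> Sorted Z.lt Y ->
  0 <= t -> 0 < r -> r < 1 ->
  (k <= N)%nat ->
  exists p : R,
    is_prob N (init_state N k Y) t (event_E N k x) p /\
    is_circle_integral N r (integrand N k x Y t)
      (Cmul (Cpow (Cmul (RtoC (2 * PI)) Ci) N) (RtoC p)).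
Proof.
  intros HN HY Hsorted Ht Hr0 Hr1 Hk.
  apply Contour.contour_formula; auto.
Qed.
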